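(* Let $\Sigma$ be a connected surface whose fundamental group is a free group of rank $\aleph_0$, and let $\mathring\Sigma=\Sigma\setminus A$ with $A\subset\Sigma$ countable and dense. Given any countable group $H$, there exists a regular covering projection $p_0:\mathring\Sigma_0\to\mathring\Sigma$, with $\mathring\Sigma_0$ a connected perforated surface, such that the deck transformation group $\mathrm{Deck}(p_0)$ is isomorphic to $H$. Moreover, $p_0$ is the restriction of a regular covering projection $p:\Sigma_0\to\Sigma$.
   Context: A surface is a paracompact 2-manifold without boundary. For a surface $\Sigma_0$, $\mathring\Sigma_0$ denotes the complement in $\Sigma_0$ of a countable dense subset; a perforated surface is such a complement in a connected surface. *)

(* Defs.v *)
From HB Require Import structures.
From mathcomp Require Import all_boot all_order all_algebra.
From mathcomp Require Import generic_quotient.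
From mathcomp Require Import all_classical all_reals all_analysis homotopy.
From mathcomp Require Import lra.
Set Implicit Arguments.
Unset Strict Implicit.
Unset Printing Implicit Defensive.
Import Order.TTheory GRing.Theory Num.Theory numFieldNormedType.Exports.

Local Open Scope classical_set_scope.
Local Open Scope ring_scope.

(* [f] restricts to a homeomorphism from the subspace [A] onto the subspace [B];
   the values of [f] and of the inverse [g] outside [A] and [B] are irrelevant. *)
Definition homeo_on (X Y : topologicalType) (A : set X) (B : set Y)
    (f : X -> Y) : Prop :=
  [/\ {homo f : x / A x >-> B x}, {within A, continuous f} &
      exists g : Y -> X,
        [/\ {homo g : y / B y >-> A y}, {within B, continuous g},
            forall x, A x -> g (f x) = x & forall y, B y -> f (g y) = y]].

Definition homeomorphism (X Y : topologicalType) (f : X -> Y) : Prop :=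
  continuous f /\
  exists g : Y -> X, [/\ continuous g, cancel f g & cancel g f].

Definition open_covering (X : topologicalType) (U : set (set X)) : Prop :=
  U `<=` open /\ \bigcup_(u in U) u = setT.

Definition locally_finite (X : topologicalType) (V : set (set X)) : Prop :=
  forall x : X, exists2 N, nbhs x N &
    finite_set [set v | V v /\ v `&` N !=set0].

Definition paracompact (X : topologicalType) : Prop :=
  hausdorff_space X /\
  forall U : set (set X), open_covering U ->
    exists V : set (set X),
      [/\ open_covering V, locally_finite V &
          forall v, V v -> exists2 u, U u & v `<=` u].

Definition locally_euclidean (R : realType) (n : nat) (X : topologicalType) :
    Prop :=
  forall x : X, exists (U : set X) (V : set 'rV[R]_n) (f : X -> 'rV[R]_n),
    [/\ open_nbhs x U, open V & homeo_on U V f].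

Definition surface (R : realType) (X : topologicalType) : Prop :=
  paracompact X /\ locally_euclidean R 2 X.

Definition connected_space (X : topologicalType) : Prop := connected [set: X].

Definition group_isomorphic (G K : groupType) : Prop :=
  exists f : {multiplicative G -> K}, bijective f.

Definition free_basis (G : groupType) (I : Type) (b : I -> G) : Prop :=
  forall (K : groupType) (f : I -> K),
    exists phi : {multiplicative G -> K},
      (forall i, phi (b i) = f i) /\
      forall psi : {multiplicative G -> K},
        (forall i, psi (b i) = f i) -> psi =1 phi.

Definition free_of_rank_aleph0 (G : groupType) : Prop :=
  exists b : nat -> G, free_basis b.

Section unit_interval.
Context (R : realType).

Definition unit_itv : Type := set_type (`[0, 1]%classic : set R).
HB.instance Definition _ := Topological.on unit_itv.

Definition ival (t : unit_itv) : R := set_val t.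

Lemma ivalP (t : unit_itv) : 0 <= ival t <= 1.
Proof. by have := set_valP t; rewrite /= in_itv. Qed.

Lemma ival_inj : injective ival.
Proof. exact: val_inj. Qed.

Lemma ival_continuous : continuous ival.
Proof. exact: initial_continuous. Qed.

(* The retraction of the line onto the interval. *)
Definition clamp (r : R) : R := Num.max 0 (Num.min r 1).

Lemma clamp_itv r : clamp r \in (`[0, 1]%classic : set R).
Proof.
rewrite inE /= in_itv /= /clamp le_max lexx /= ge_max ler01 /=.
by rewrite ge_min lexx orbT.
Qed.

Lemma clamp_id r : 0 <= r <= 1 -> clamp r = r.
Proof. by move=> /andP[r0 r1]; rewrite /clamp (min_l r1) (max_r r0). Qed.

Definition iproj (r : R) : unit_itv := exist _ (clamp r) (clamp_itv r).

Lemma iprojK r : 0 <= r <= 1 -> ival (iproj r) = r.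
Proof. exact: clamp_id. Qed.

Lemma ivalK : cancel ival iproj.
Proof. by move=> t; apply: ival_inj; rewrite iprojK ?ivalP. Qed.

Lemma clamp_continuous : continuous clamp.
Proof.
move=> r; apply: (@continuous_max R R (cst 0) (fun x => Num.min x 1)).
  exact: cvg_cst.
by apply: (@continuous_min R R id (cst 1)); [exact: cvg_id|exact: cvg_cst].
Qed.

Lemma iproj_continuous : continuous iproj.
Proof.
apply/continuousP => _ [B oB <-].
by apply: (proj1 (continuousP _) clamp_continuous).
Qed.

Lemma iproj01 : iproj 0 != iproj 1.
Proof.
apply/eqP => /(congr1 ival); rewrite !iprojK ?lexx ?ler01 //.
by apply/eqP; rewrite eq_sym oner_eq0.
Qed.

HB.instance Definition _ := isBiPointed.Build unit_itv iproj01.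

Lemma ival0 : ival zero = 0.
Proof. by rewrite iprojK ?lexx ?ler01. Qed.

Lemma ival1 : ival one = 1.
Proof. by rewrite iprojK ?lexx ?ler01. Qed.

End unit_interval.

Section pasting.
Context (R : realType) (T X : topologicalType).

Lemma continuous_if_le (h : T -> R) (c : R) (f g : T -> X) :
  continuous h -> continuous f -> continuous g ->
  (forall z, h z = c -> f z = g z) ->
  continuous (fun z => if h z <= c then f z else g z).
Proof.
move=> ch cf cg fg z; case: (ltgtP (h z) c) => hz.
- rewrite /continuous_at (ltW hz); apply: cvg_trans (cf z).
  apply: near_eq_cvg; have : \forall w \near z, h w < c.
    exact: (ch z (fun r => r < c) (lt_nbhsl hz)).
  by apply: filterS => w /ltW ->.
- rewrite /continuous_at leNgt hz /=; apply: cvg_trans (cg z).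
  apply: near_eq_cvg; have : \forall w \near z, c < h w.
    exact: (ch z (fun r => c < r) (lt_nbhsr hz)).
  by apply: filterS => w; rewrite leNgt => ->.
- rewrite /continuous_at hz lexx => U Uz.
  have fU : nbhs z (f @^-1` U) by exact: cf z U Uz.
  have gU : nbhs z (g @^-1` U) by apply: (cg z U); rewrite -fg.
  by apply: filterS (filterI fU gU) => w [? ?] /=; case: ifP.
Qed.

End pasting.

Notation ipath R x y := ({path (unit_itv R) from x to y}).

Section path_homotopy.
Context (R : realType) (X : topologicalType).
Implicit Types x y z w : X.
Local Notation I := (unit_itv R).
Local Notation ival := (@ival R).
Local Notation iproj := (@iproj R).

Definition path_homotopic x y (p q : ipath R x y) : Prop :=
  exists H : I * I -> X,
    [/\ continuous H,
        (forall s, H (s, zero) = p s) /\ (forall s, H (s, one) = q s) &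
        (forall t, H (zero, t) = x) /\ (forall t, H (one, t) = y)].

Definition concat_fun x y z (p : ipath R x y) (q : ipath R y z) (s : I) : X :=
  if ival s <= 2^-1 then p (iproj (2 * ival s))
  else q (iproj (2 * ival s - 1)).


Section real_continuity.
Context (T : topologicalType) (f g : T -> R).
Hypotheses (cf : continuous f) (cg : continuous g).

Local Lemma addf_continuous : continuous (fun t => f t + g t).
Proof. by move=> t; apply: cvgD; [exact: cf|exact: cg]. Qed.

Local Lemma oppf_continuous : continuous (fun t => - f t).
Proof. by move=> t; apply: cvgN; exact: cf. Qed.

Local Lemma mulf_continuous : continuous (fun t => f t * g t).
Proof. by move=> t; apply: cvgM; [exact: cf|exact: cg]. Qed.

End real_continuity.

Lemma ival_fst_continuous : continuous (fun z : I * I => ival z.1).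
Proof.
by move=> z; apply: continuous_comp; [exact: cvg_fst|exact: ival_continuous].
Qed.

Lemma ival_snd_continuous : continuous (fun z : I * I => ival z.2).
Proof.
by move=> z; apply: continuous_comp; [exact: cvg_snd|exact: ival_continuous].
Qed.

Local Ltac cts := repeat lazymatch goal with
  | |- continuous (fun t => _ + _) => apply: addf_continuous
  | |- continuous (fun t => - _) => apply: oppf_continuous
  | |- continuous (fun t => _ * _) => apply: mulf_continuous
  | |- continuous ( *%R _) => apply: mulf_continuous
  | |- continuous (fun t => t) => move=> ?; exact: cvg_id
  | |- continuous id => move=> ?; exact: cvg_id
  | |- continuous (fun t => ival t.1) => exact: ival_fst_continuous
  | |- continuous (fun t => ival t.2) => exact: ival_snd_continuous
  | |- continuous (fun t => ival t) => exact: ival_continuous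
  | |- continuous (ival) => exact: ival_continuous
  | |- continuous (fun t => _) => exact: cst_continuous
  end.

Lemma ext_continuous (T : topologicalType) x y (p : ipath R x y) (f : T -> R) :
  continuous f -> continuous (fun t => p (iproj (f t))).
Proof.
move=> cf t; apply: (@continuous_comp _ _ _ (fun t => iproj (f t)) p).
  by apply: continuous_comp; [exact: cf|exact: iproj_continuous].
exact: cts_fun.
Qed.

Lemma ext2_continuous (T : topologicalType) (H : I * I -> X) (f g : T -> R) :
  continuous H -> continuous f -> continuous g ->
  continuous (fun t => H (iproj (f t), iproj (g t))).
Proof.
move=> cH cf cg t.
apply: (@continuous_comp _ _ _ (fun t => (iproj (f t), iproj (g t))) H).
  have c1 : {for t, continuous (fun t => iproj (f t))}.
    by apply: continuous_comp; [exact: cf|exact: iproj_continuous].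
  have c2 : {for t, continuous (fun t => iproj (g t))}.
    by apply: continuous_comp; [exact: cg|exact: iproj_continuous].
  exact: (cvg_pair c1 c2).
exact: cH.
Qed.

Lemma iproj0E r : r = 0 -> iproj r = zero. Proof. by move->. Qed.

Lemma iproj1E r : r = 1 -> iproj r = one. Proof. by move->. Qed.

Lemma half_ge0 : (0 : R) <= 2^-1. Proof. by lra. Qed.

Lemma half_lt1 : (1 <= 2^-1 :> R) = false.
Proof. by apply/negbTE; rewrite -ltNge; lra. Qed.

Section concat.
Context x y z (p : ipath R x y) (q : ipath R y z).

Local Lemma concat_continuous : continuous (concat_fun p q).
Proof.
apply: continuous_if_le.
- exact: ival_continuous.
- by apply: ext_continuous; cts.
- by apply: ext_continuous; cts.
- move=> s ->; rewrite iproj1E; last lra.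
  by rewrite iproj0E ?path_zero ?path_one//; lra.
Qed.

Local Lemma concat_zero : concat_fun p q zero = x.
Proof. by rewrite /concat_fun ival0 half_ge0 mulr0 path_zero. Qed.

Local Lemma concat_one : concat_fun p q one = z.
Proof.
by rewrite /concat_fun ival1 half_lt1 iproj1E ?path_one//; lra.
Qed.

Definition concat : ipath R x z :=
  mk_path concat_continuous concat_zero concat_one.

Lemma concat_iproj r : 0 <= r <= 1 ->
  concat (iproj r) =
  if r <= 2^-1 then p (iproj (2 * r)) else q (iproj (2 * r - 1)).
Proof. by move=> r01; rewrite /= /mk_path /concat_fun iprojK. Qed.

Lemma concatE s : concat s =
  if ival s <= 2^-1 then p (iproj (2 * ival s)) else q (iproj (2 * ival s - 1)).
Proof. by []. Qed.

End concat.

Section reverse.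
Context x y (p : ipath R x y).

Definition reverse_fun (s : I) : X := p (iproj (1 - ival s)).

Local Lemma reverse_continuous : continuous reverse_fun.
Proof. by apply: ext_continuous; cts. Qed.

Local Lemma reverse_zero : reverse_fun zero = y.
Proof. by rewrite /reverse_fun ival0 subr0 path_one. Qed.

Local Lemma reverse_one : reverse_fun one = x.
Proof. by rewrite /reverse_fun ival1 subrr path_zero. Qed.

Definition reverse : ipath R y x :=
  mk_path reverse_continuous reverse_zero reverse_one.

End reverse.

Definition const_path x : ipath R x x := cst x.

Lemma reparam_homotopic (u v : R -> R) (F : R -> X) x y (p q : ipath R x y) :
  continuous F -> continuous u -> continuous v -> u 0 = v 0 -> u 1 = v 1 ->
  (forall s, 0 <= s <= 1 -> p (iproj s) = F (u s)) ->
  (forall s, 0 <= s <= 1 -> q (iproj s) = F (v s)) ->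
  path_homotopic p q.
Proof.
move=> cF cu cv uv0 uv1 pE qE.
have pE' s : p s = F (u (ival s)) by rewrite -pE ?ivalP// ivalK.
have qE' s : q s = F (v (ival s)) by rewrite -qE ?ivalP// ivalK.
exists (fun c => F ((1 - ival c.2) * u (ival c.1) + ival c.2 * v (ival c.1))).
split.
- move=> c; apply: (@continuous_comp _ _ _ (fun c : I * I =>
    (1 - ival c.2) * u (ival c.1) + ival c.2 * v (ival c.1)) F); last exact: cF.
  have c1 : {for c, continuous (fun c : I * I => u (ival c.1))}.
    by apply: (@continuous_comp _ _ _ (fun c : I * I => ival c.1) u);
      [exact: ival_fst_continuous|exact: cu].
  have c2 : {for c, continuous (fun c : I * I => v (ival c.1))}.
    by apply: (@continuous_comp _ _ _ (fun c : I * I => ival c.1) v);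
      [exact: ival_fst_continuous|exact: cv].
  have c3 : {for c, continuous (fun c : I * I => ival c.2)}.
    exact: ival_snd_continuous.
  apply: cvgD; last by apply: cvgM.
  by apply: cvgM => //; apply: cvgB => //; exact: cvg_cst.
- split=> s /=.
    by rewrite ival0 subr0 mul1r mul0r addr0 pE'.
  by rewrite ival1 subrr mul0r mul1r add0r qE'.
- split=> t /=.
    rewrite ival0 -uv0 -mulrDl subrK mul1r.
    by rewrite -[in RHS](path_zero (s := p)) pE' ival0.
  rewrite ival1 -uv1 -mulrDl subrK mul1r.
  by rewrite -[in RHS](path_one (s := p)) pE' ival1.
Qed.

Lemma path_homotopic_refl x y (p : ipath R x y) : path_homotopic p p.
Proof.
apply: (@reparam_homotopic id id (fun r => p (iproj r))) => //.
- by apply: ext_continuous; cts.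
- by cts.
- by cts.
Qed.

Lemma path_homotopic_sym x y (p q : ipath R x y) :
  path_homotopic p q -> path_homotopic q p.
Proof.
move=> [H [cH [H0 H1] [Hx Hy]]].
exists (fun c => H (iproj (ival c.1), iproj (1 - ival c.2))); split.
- apply: ext2_continuous => //; first exact: ival_fst_continuous.
  by cts.
- by split=> s /=; rewrite ivalK ?ival0 ?ival1 ?subr0 ?subrr.
- by split=> t /=; rewrite ivalK.
Qed.

Lemma path_homotopic_trans x y (p q r : ipath R x y) :
  path_homotopic p q -> path_homotopic q r -> path_homotopic p r.
Proof.
move=> [H [cH [H0 H1] [Hx Hy]]] [K [cK [K0 K1] [Kx Ky]]].
exists (fun c => if ival c.2 <= 2^-1
  then H (iproj (ival c.1), iproj (2 * ival c.2))
  else K (iproj (ival c.1), iproj (2 * ival c.2 - 1))); split.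
- apply: continuous_if_le.
  + exact: ival_snd_continuous.
  + apply: ext2_continuous => //; first exact: ival_fst_continuous.
    by cts.
  + apply: ext2_continuous => //; first exact: ival_fst_continuous.
    by cts.
  + move=> c ->; rewrite !ivalK (@iproj1E (2 * _)); last lra.
    by rewrite (@iproj0E (_ - 1)) ?H1 ?K0//; lra.
- split=> s /=; first by rewrite ivalK ival0 half_ge0 mulr0 H0.
  by rewrite ivalK ival1 half_lt1 iproj1E ?K1//; lra.
- by split=> t /=; rewrite ivalK ?Hx ?Hy ?Kx ?Ky; case: ifP.
Qed.

Lemma concat_homotopic x y z (p p' : ipath R x y) (q q' : ipath R y z) :
  path_homotopic p p' -> path_homotopic q q' ->
  path_homotopic (concat p q) (concat p' q').
Proof.
move=> [H [cH [H0 H1] [Hx Hy]]] [K [cK [K0 K1] [Kx Ky]]].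
exists (fun c => if ival c.1 <= 2^-1
  then H (iproj (2 * ival c.1), iproj (ival c.2))
  else K (iproj (2 * ival c.1 - 1), iproj (ival c.2))); split.
- apply: continuous_if_le.
  + exact: ival_fst_continuous.
  + apply: ext2_continuous => //; last exact: ival_snd_continuous.
    by cts.
  + apply: ext2_continuous => //; last exact: ival_snd_continuous.
    by cts.
  + move=> t ->; rewrite !ivalK (@iproj1E (2 * _)); last lra.
    by rewrite (@iproj0E (_ - 1)) ?Hy ?Kx//; lra.
- by split=> s; rewrite concatE /= ivalK ?H0 ?H1 ?K0 ?K1.
- split=> t /=; rewrite ivalK ?ival0 ?ival1.
    by rewrite half_ge0 mulr0 Hx.
  by rewrite half_lt1 iproj1E ?Ky//; lra.
Qed.

Lemma reverse_homotopic x y (p p' : ipath R x y) :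
  path_homotopic p p' -> path_homotopic (reverse p) (reverse p').
Proof.
move=> [H [cH [H0 H1] [Hx Hy]]].
exists (fun c => H (iproj (1 - ival c.1), iproj (ival c.2))); split.
- apply: ext2_continuous => //; last exact: ival_snd_continuous.
  by cts.
- by split=> s /=; rewrite ivalK ?H0 ?H1.
- by split=> t /=; rewrite ivalK ?ival0 ?ival1 ?subr0 ?subrr.
Qed.

Lemma concatA_homotopic x y z w (p : ipath R x y) (q : ipath R y z)
    (r : ipath R z w) :
  path_homotopic (concat p (concat q r)) (concat (concat p q) r).
Proof.
pose v (s : R) := if s <= 2^-1 then (if s <= 4^-1 then 2 * s else s + 4^-1)
                  else (s + 1) / 2.
apply: (@reparam_homotopic id v (fun s => concat p (concat q r) (iproj s))).
- by apply: ext_continuous; cts.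
- by cts.
- apply: continuous_if_le.
  + by cts.
  + apply: continuous_if_le; [by cts..|].
    by move=> t ->; lra.
  + by cts.
  + by move=> t ->; case: ifPn => //; rewrite -?ltNge; lra.
- by rewrite /v; do 2?case: ifPn; rewrite -?ltNge; lra.
- by rewrite /v; do 2?case: ifPn; rewrite -?ltNge; lra.
- by [].
- move=> s s01; rewrite /v concat_iproj//.
  case: ifPn; rewrite -?ltNge => s2.
    rewrite concat_iproj; last lra.
    case: ifPn; rewrite -?ltNge => s4.
      rewrite ifT; last lra.
      rewrite concat_iproj; last lra.
      by rewrite ifT//; lra.
    rewrite ifF; last by apply/negbTE; rewrite -ltNge; lra.
    rewrite concat_iproj; last lra.
    rewrite ifF; last by apply/negbTE; rewrite -ltNge; lra.
    rewrite concat_iproj; last lra.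
    rewrite ifT; last lra.
    by congr (q (iproj _)); lra.
  rewrite concat_iproj; last lra.
  rewrite ifF; last by apply/negbTE; rewrite -ltNge; lra.
  rewrite concat_iproj; last lra.
  rewrite ifF; last by apply/negbTE; rewrite -ltNge; lra.
  by congr (r (iproj _)); lra.
Qed.

Lemma concat1p_homotopic x y (p : ipath R x y) :
  path_homotopic (concat (const_path x) p) p.
Proof.
apply: (@reparam_homotopic (fun s => if s <= 2^-1 then 0 else 2 * s - 1) id
  (fun s => p (iproj s))) => //.
- by apply: ext_continuous; cts.
- by apply: continuous_if_le; [by cts..|move=> t ->; lra].
- by cts.
- by rewrite half_ge0.
- by rewrite half_lt1; lra.
- move=> s s01; rewrite concat_iproj//.
  by case: ifP => // _; rewrite path_zero.
Qed.

Lemma concatp1_homotopic x y (p : ipath R x y) :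
  path_homotopic (concat p (const_path y)) p.
Proof.
apply: (@reparam_homotopic (fun s => if s <= 2^-1 then 2 * s else 1) id
  (fun s => p (iproj s))) => //.
- by apply: ext_continuous; cts.
- by apply: continuous_if_le; [by cts..|move=> t ->; lra].
- by cts.
- by rewrite half_ge0 mulr0.
- by rewrite half_lt1.
- move=> s s01; rewrite concat_iproj//.
  by case: ifP => // _; rewrite path_one.
Qed.

Lemma concatVp_homotopic x y (p : ipath R x y) :
  path_homotopic (concat (reverse p) p) (const_path y).
Proof.
apply: (@reparam_homotopic (fun s => if s <= 2^-1 then 1 - 2 * s else 2 * s - 1)
  (cst 1) (fun s => p (iproj s))).
- by apply: ext_continuous; cts.
- by apply: continuous_if_le; [by cts..|move=> t ->; lra].
- exact: cst_continuous.
- by rewrite half_ge0 mulr0 subr0.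
- by rewrite half_lt1 /=; lra.
- move=> s s01; rewrite concat_iproj//; case: ifPn => // s2.
  by rewrite /= /mk_path /reverse_fun iprojK//; lra.
- by move=> s s01; rewrite path_one.
Qed.

Lemma concatpV_homotopic x y (p : ipath R x y) :
  path_homotopic (concat p (reverse p)) (const_path x).
Proof.
apply: (@reparam_homotopic (fun s => if s <= 2^-1 then 2 * s else 2 - 2 * s)
  (cst 0) (fun s => p (iproj s))).
- by apply: ext_continuous; cts.
- by apply: continuous_if_le; [by cts..|move=> t ->; lra].
- exact: cst_continuous.
- by rewrite half_ge0 mulr0.
- by rewrite half_lt1 /=; lra.
- move=> s s01; rewrite concat_iproj//; case: ifPn; rewrite -?ltNge => // s2.
  rewrite /= /mk_path /reverse_fun iprojK; last lra.
  by congr (p (iproj _)); lra.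
- by move=> s s01; rewrite path_zero.
Qed.

End path_homotopy.

Section fundamental_group.
Context (R : realType) (X : topologicalType) (x0 : X).

Definition loop_eq (p q : ipath R x0 x0) : bool := `[< path_homotopic p q >].

Local Lemma loop_eq_refl : reflexive loop_eq.
Proof. by move=> p; apply/asboolP; exact: path_homotopic_refl. Qed.

Local Lemma loop_eq_sym : symmetric loop_eq.
Proof. by move=> p q; apply/asboolP/asboolP; exact: path_homotopic_sym. Qed.

Local Lemma loop_eq_trans : transitive loop_eq.
Proof.
move=> q p r /asboolP pq /asboolP qr; apply/asboolP.
exact: path_homotopic_trans pq qr.
Qed.

Canonical loop_equiv := EquivRel loop_eq loop_eq_refl loop_eq_sym loop_eq_trans.

Definition pi1 : Type := {eq_quot loop_equiv}%qT.
HB.instance Definition _ := Choice.on pi1.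

Definition loop_class (p : ipath R x0 x0) : pi1 := \pi_({eq_quot loop_equiv})%qT p.

Lemma loop_classP (p q : ipath R x0 x0) :
  loop_class p = loop_class q <-> path_homotopic p q.
Proof.
split=> [/eqquotP/asboolP//|pq].
by apply/eqquotP/asboolP.
Qed.

Lemma loop_class_surj (a : pi1) : exists p, a = loop_class p.
Proof.
by exists (repr (a : {eq_quot loop_equiv}%qT)); rewrite /loop_class reprK.
Qed.

Definition loop_repr (a : pi1) : ipath R x0 x0 :=
  repr (a : {eq_quot loop_equiv}%qT).

Lemma loop_reprK : cancel loop_repr loop_class.
Proof. by move=> a; rewrite /loop_class /loop_repr reprK. Qed.

Definition pi1_one : pi1 := loop_class (const_path R x0).
Definition pi1_mul (a b : pi1) : pi1 :=
  loop_class (concat (loop_repr a) (loop_repr b)).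
Definition pi1_inv (a : pi1) : pi1 := loop_class (reverse (loop_repr a)).

Lemma pi1_mulE p q :
  pi1_mul (loop_class p) (loop_class q) = loop_class (concat p q).
Proof.
by apply/loop_classP/concat_homotopic; apply/loop_classP; rewrite loop_reprK.
Qed.

Lemma pi1_invE p : pi1_inv (loop_class p) = loop_class (reverse p).
Proof.
by apply/loop_classP/reverse_homotopic; apply/loop_classP; rewrite loop_reprK.
Qed.

Local Lemma pi1_mulA : associative pi1_mul.
Proof.
move=> a b c; rewrite -(loop_reprK a) -(loop_reprK b) -(loop_reprK c).
by rewrite !pi1_mulE; apply/loop_classP; exact: concatA_homotopic.
Qed.

Local Lemma pi1_mul1 : left_id pi1_one pi1_mul.
Proof.
move=> a; rewrite -(loop_reprK a) pi1_mulE.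
by apply/loop_classP; exact: concat1p_homotopic.
Qed.

Local Lemma pi1_mulr1 : right_id pi1_one pi1_mul.
Proof.
move=> a; rewrite -(loop_reprK a) pi1_mulE.
by apply/loop_classP; exact: concatp1_homotopic.
Qed.

Local Lemma pi1_mulV : left_inverse pi1_one pi1_inv pi1_mul.
Proof.
move=> a; rewrite -(loop_reprK a) pi1_invE pi1_mulE.
by apply/loop_classP; exact: concatVp_homotopic.
Qed.

Local Lemma pi1_mulrV : right_inverse pi1_one pi1_inv pi1_mul.
Proof.
move=> a; rewrite -(loop_reprK a) pi1_invE pi1_mulE.
by apply/loop_classP; exact: concatpV_homotopic.
Qed.

HB.instance Definition _ :=
  isGroup.Build pi1 pi1_mulA pi1_mul1 pi1_mulr1 pi1_mulV pi1_mulrV.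

End fundamental_group.

Definition evenly_covered (E X : topologicalType) (p : E -> X) (U : set X) :
    Prop :=
  exists S : set (set E),
    [/\ S `<=` open, trivIset S id, \bigcup_(V in S) V = p @^-1` U &
        forall V, S V -> homeo_on V U p].

Definition covering_projection (E X : topologicalType) (p : E -> X) : Prop :=
  [/\ continuous p, set_surj setT setT p &
      forall x, exists2 U, open_nbhs x U & evenly_covered p U].

Section deck.
Context (E X : topologicalType) (p : E -> X).

Definition deck_transformation (f : E -> E) : Prop :=
  homeomorphism f /\ p \o f = p.

Definition deck : Type := {f : E -> E | deck_transformation f}.
HB.instance Definition _ := gen_eqMixin deck.
HB.instance Definition _ := gen_choiceMixin deck.

Definition deck_fun (d : deck) : E -> E := proj1_sig d.
Coercion deck_fun : deck >-> Funclass.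

Lemma deck_inj (d d' : deck) : d =1 d' -> d = d'.
Proof.
case: d d' => [f Pf] [g Pg] fg; have {}fg : f = g by exact/funext.
by case: _ / fg in Pg *; congr exist; exact: Prop_irrelevance.
Qed.

Local Lemma deck_one_subproof : deck_transformation id.
Proof.
split; last by [].
by split; [move=> x; exact: cvg_id|exists id; split=> // x; exact: cvg_id].
Qed.

Local Lemma deck_mul_subproof (d d' : deck) : deck_transformation (d \o d').
Proof.
case: d d' => [f [[cf [f' [cf' fK f'K]]] pf]] [g [[cg [g' [cg' gK g'K]]] pg]].
split; last by rewrite compA pf.
split; first by move=> x; apply: continuous_comp; [exact: cg|exact: cf].
exists (g' \o f'); split.
- by move=> x; apply: continuous_comp; [exact: cf'|exact: cg'].
- exact: can_comp.
- exact: can_comp.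
Qed.

Local Lemma deck_inv_subproof (d : deck) :
  {g : E -> E | deck_transformation g & cancel d g /\ cancel g d}.
Proof.
apply/cid2; case: d => [f [[cf [g [cg fK gK]]] pf]]; exists g => //.
split; first by split=> //; exists f.
by rewrite -[in LHS]pf -compA; apply/funext => x /=; rewrite gK.
Qed.

Definition deck_one : deck := exist _ id deck_one_subproof.
Definition deck_mul (d d' : deck) : deck := exist _ _ (deck_mul_subproof d d').
Definition deck_inv (d : deck) : deck :=
  exist _ _ (s2valP (deck_inv_subproof d)).

Local Lemma deck_mulA : associative deck_mul.
Proof. by move=> a b c; exact: deck_inj. Qed.

Local Lemma deck_mul1 : left_id deck_one deck_mul.
Proof. by move=> a; exact: deck_inj. Qed.

Local Lemma deck_mulr1 : right_id deck_one deck_mul.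
Proof. by move=> a; exact: deck_inj. Qed.

Local Lemma deck_mulV : left_inverse deck_one deck_inv deck_mul.
Proof.
by move=> a; apply: deck_inj; exact: (s2valP' (deck_inv_subproof a)).1.
Qed.

Local Lemma deck_mulrV : right_inverse deck_one deck_inv deck_mul.
Proof.
by move=> a; apply: deck_inj; exact: (s2valP' (deck_inv_subproof a)).2.
Qed.

HB.instance Definition _ :=
  isGroup.Build deck deck_mulA deck_mul1 deck_mulr1 deck_mulV deck_mulrV.

End deck.

Definition regular_covering (E X : topologicalType) (p : E -> X) : Prop :=
  covering_projection p /\
  forall e e', p e = p e' -> exists d : deck p, d e = e'.

(* [X] punctured along [A], with the subspace topology. *)
Definition perforated (X : topologicalType) (A : set X) : topologicalType :=
  set_type (~` A).

(* Main.v *)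
Require Import Defs.
From HB Require Import structures.
From mathcomp Require Import all_boot all_order all_algebra.
From mathcomp Require Import all_classical all_reals all_analysis homotopy.
From mathcomp Require Import lra.
Set Implicit Arguments.
Unset Strict Implicit.
Unset Printing Implicit Defensive.
Import Order.TTheory GRing.Theory Num.Theory numFieldNormedType.Exports.

Local Open Scope classical_set_scope.
Local Open Scope ring_scope.

(* Since [pi1] is free of countable rank, it surjects onto [H] by some [phi].
   Fixing paths [gam x] from [x0] to [x], every path from [x] to [y] gets a
   holonomy in [H], the image under [phi] of the loop closed up by [gam x] and
   [gam y]. The covering is the product of the surface with [H], glued over small
   disks by holonomy; [H] acts by left translations, and surjectivity of [phi]
   makes the total space connected. A connected surface minus a countable set is
   still connected, so a deck transformation of the punctured covering differs
   from the identity by a locally constant, hence constant, element of [H]. *)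

(** The covering belongs to the kernel of [phi], but no universal covering or quotient is formed.
    The paths [gam x] trivialise all fibres at once, though not continuously, so the total space is
    the set [X * H] and only its topology has to be built. Sheets are twisted on the right and [H]
    translates on the left; the two commute, so translations are continuous. Countability of [H]
    enters twice: each element of [H] can be the image of a free generator, and the preimage of [A]
    stays countable, so the total space remains connected off it. The deck group is computed on the
    punctured covering itself, since a deck transformation there is not known beforehand to extend
    over the punctures. Paracompactness is not a local property, and its transfer to the total space
    needs an argument of its own. *)

(** * Planar disks minus a countable set *)

Lemma connected_between (T : topologicalType) (A B : set T) :
  connected A -> A `<=` B -> B `<=` closure A -> connected B.
Proof.
move=> cA AB BA; apply/connectedP => E [E0 BE sE].
wlog AE : E E0 BE sE / A `<=` E false.
  move=> wlg; have [|AE|AE] := connected_subset sE _ cA; first by rewrite -BE.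
    exact: (wlg E E0 BE sE).
  apply: (wlg (E \o negb)) => //=; last by rewrite separatedC.
  by rewrite setUC.
have [x Ex] := E0 true; have [EE _] := sE.
have : (closure (E false) `&` E true) x.
  by split=> //; apply: (closureS AE); apply: BA; rewrite BE; right.
by rewrite EE.
Qed.

(** A countable set is Lebesgue null, while the interval has measure [b - a]. *)
Lemma itv_avoid_countable (R : realType) (C : set R) (a b : R) :
  countable C -> a < b -> exists2 t, a < t < b & ~ C t.
Proof.
move=> cC ab; apply: contrapT => abC.
have sub : `]a, b[%classic `<=` C.
  move=> t /=; rewrite in_itv /= => tab; apply: contrapT => Ct.
  by apply: abC; exists t.
have := countable_lebesgue_measure0 (sub_countable (subset_card_le sub) cC).
rewrite lebesgue_measure_itv /= lte_fin ab -EFinD => -[] ba.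
by move: ab; rewrite -subr_gt0 ba ltxx.
Qed.

Section planar.
Context (R : realType).

Definition pt2 (s t : R) : 'rV[R]_2 := \row_j (if j == ord0 then s else t).

Lemma pt2_eta (w : 'rV[R]_2) : w = pt2 (w ord0 ord0) (w ord0 ord_max).
Proof.
apply/rowP => j; rewrite mxE; case: ifPn => [/eqP->//|].
by case: j => -[|[|//]] j2 // _; congr (w _ _); apply: val_inj.
Qed.

(** Balls of row vectors are taken in the sup norm: they are squares, and the two coordinates move
    independently. *)
Lemma ball_pt2 (v : 'rV[R]_2) e s t : 0 < e ->
  ball v e (pt2 s t) <->
  `|v ord0 ord0 - s| < e /\ `|v ord0 ord_max - t| < e.
Proof.
move=> e0; split=> [[_ b]|[bs bt]].
  by split; [have := b ord0 ord0|have := b ord0 ord_max]; rewrite mxE.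
split=> // i j; rewrite (ord1 i) mxE; case: ifPn => [/eqP->//|].
case: j => -[|[|//]] j2 // _.
by rewrite (_ : Ordinal j2 = ord_max) //; apply: val_inj.
Qed.

Lemma continuous_pt2 (T : topologicalType) (f g : T -> R) :
  continuous f -> continuous g -> continuous (fun t => pt2 (f t) (g t)).
Proof.
move=> cf cg t; apply/cvgrPdist_lt => e e0.
have nf := (cvgrPdist_lt _ _).1 (cf t) e e0.
have ng := (cvgrPdist_lt _ _).1 (cg t) e e0.
near=> u.
suff : ball (pt2 (f t) (g t)) e (pt2 (f u) (g u)) by rewrite -ball_normE.
apply/(ball_pt2 _ _ _ e0); rewrite !mxE /=.
by split; near: u; [exact: nf|exact: ng].
Unshelve. all: by end_near. Qed.

(* Vertical lines missing [C], joined by one horizontal line missing [C], form a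
   dense connected comb. *)
Lemma ball_minus_countable (v : 'rV[R]_2) e (C : set 'rV[R]_2) :
  0 < e -> countable C ->
  connected (ball v e `\` C) /\ ball v e `\` C !=set0.
Proof.
move=> e0 cC; set a := v ord0 ord0; set b := v ord0 ord_max.
pose Cx := (fun w : 'rV[R]_2 => w ord0 ord0) @` C.
pose Cy := (fun w : 'rV[R]_2 => w ord0 ord_max) @` C.
have cCx : countable Cx by apply: card_le_trans (card_image_le _ _) cC.
have cCy : countable Cy by apply: card_le_trans (card_image_le _ _) cC.
pose J (c : R) : set R := [set r : R | `|c - r| < e].
have cJ c : connected (J c).
  apply/connected_intervalP => x y; rewrite /J /= => xJ yJ z.
  by move: xJ yJ; rewrite !ltr_norml; lra.
have [t0 t0J t0C] : exists2 t, `|b - t| < e & ~ Cy t.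
  have [|t tJ tC] := @itv_avoid_countable _ _ (b - e) (b + e) cCy; first lra.
  by exists t => //; rewrite ltr_norml; lra.
pose L (s : R) := (pt2 s) @` J b.
pose H0 := (fun s => pt2 s t0) @` J a.
have cL s : connected (L s).
  apply: connected_continuous_connected => //; apply: continuous_subspaceT.
  by apply: continuous_pt2 => ?; [exact: cvg_cst|exact: cvg_id].
have cH0 : connected H0.
  apply: connected_continuous_connected => //; apply: continuous_subspaceT.
  by apply: continuous_pt2 => ?; [exact: cvg_id|exact: cvg_cst].
pose good s := J a s /\ ~ Cx s.
(* [H0] is repeated in every member so that all members share the point [pt2 a t0]. *)
pose comb := \bigcup_(s in good) (L s `|` H0).
have ccomb : connected comb.
  apply: bigcup_connected => [|s [sJ sC]].
    exists (pt2 a t0) => s _; right; exists a => //.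
    by rewrite /J /= subrr normr0.
  by apply: connectedU => //; exists (pt2 s t0); split; [exists t0|exists s].
have combB : comb `<=` ball v e `\` C.
  move=> w [s [sJ sC]] [[t tJ <-]|[s' s'J <-]].
    split; first exact/ball_pt2.
    by move=> Cst; apply: sC; exists (pt2 s t) => //; rewrite mxE.
  split; first exact/ball_pt2.
  by move=> Cst; apply: t0C; exists (pt2 s' t0) => //; rewrite mxE.
have Bcomb : ball v e `<=` closure comb.
  move=> w bw; rewrite (pt2_eta w) in bw *.
  set s := w _ _ in bw *; set t := w _ _ in bw *.
  have [sJ tJ] := (ball_pt2 _ _ _ e0).1 bw.
  move=> N /nbhs_ballP [d /= d0 dN].
  have [s' s'I s'C] : exists2 s', Num.max (s - d) (a - e) < s' <
      Num.min (s + d) (a + e) & ~ Cx s'.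
    apply: itv_avoid_countable => //.
    by move: sJ; rewrite ltr_norml lt_min !gt_max -/a; lra.
  move: s'I; rewrite lt_min !gt_max => /andP[/andP[? ?] /andP[? ?]].
  exists (pt2 s' t); split.
    exists s'; first by split=> //; rewrite /J /= ltr_norml; lra.
    by left; exists t.
  apply: dN; apply/ball_pt2 => //; rewrite !mxE /= subrr normr0; split=> //.
  by rewrite ltr_norml; lra.
split.
  by apply: connected_between ccomb combB _ => w [/Bcomb].
have [w [cw _]] := Bcomb v (ballxx v e0) setT filterT.
by exists w; exact: combB.
Qed.

End planar.

(** * Ball charts and simple neighbourhoods *)

Lemma homeo_on_open (X Y : topologicalType) (A : set X) (B : set Y)
    (f : X -> Y) : open A -> open B ->
  homeo_on A B f <-> [/\ {homo f : x / A x >-> B x}, {in A, continuous f} &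
      exists g : Y -> X,
        [/\ {homo g : y / B y >-> A y}, {in B, continuous g},
            forall x, A x -> g (f x) = x & forall y, B y -> f (g y) = y]].
Proof.
move=> oA oB; rewrite /homeo_on continuous_open_subspace //.
by split=> -[? ? [g [? cg ? ?]]]; split=> //; exists g; split=> //;
  move: cg; rewrite continuous_open_subspace.
Qed.

Lemma open_in_preimage (X Y : topologicalType) (A : set X) (f : X -> Y) :
  open A -> {in A, continuous f} -> forall B, open B -> open (A `&` f @^-1` B).
Proof. by move=> oA /(continuous_inP _ oA). Qed.

Lemma homeo_on_restrict (X Y : topologicalType) (A O : set X) (B : set Y)
    (f : X -> Y) : open A -> open B -> open O -> homeo_on A B f ->
  open (f @` (A `&` O)) /\ homeo_on (A `&` O) (f @` (A `&` O)) f.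
Proof.
move=> oA oB oO /(homeo_on_open _ oA oB) [fAB cf [g [gBA cg fK gK]]].
have imE : f @` (A `&` O) = B `&` g @^-1` (A `&` O).
  apply/seteqP; split=> [_ [x [Ax Ox] <-]|y [By [Ay Oy]]].
    by split; [exact: fAB|rewrite /preimage /= fK].
  by exists (g y) => //; exact: gK.
have oim : open (f @` (A `&` O)).
  by rewrite imE; apply: open_in_preimage => //; exact: openI.
split=> //; apply/homeo_on_open => //; first exact: openI.
split; first by move=> x AOx; exists x.
  by move=> x; rewrite inE => -[Ax _]; apply: cf; rewrite inE.
exists g; split.
- by move=> _ [x [Ax Ox] <-]; rewrite fK.
- by move=> y; rewrite imE inE => -[By _]; apply: cg; rewrite inE.
- by move=> x [Ax _]; exact: fK.
- by move=> y; rewrite imE => -[By _]; exact: gK.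
Qed.

(** Later uses of charts rely on a ball as target: it is convex, and in the plane it carries the
    comb. The chart is cut down to [O], then to the preimage of a ball inside its open image. *)
Lemma chart_ball (R : realType) n (X : topologicalType) (x : X) (O : set X) :
  locally_euclidean R n X -> open_nbhs x O ->
  exists (W : set X) (v : 'rV[R]_n) (e : R) (f : X -> 'rV[R]_n),
    [/\ 0 < e, open_nbhs x W, W `<=` O & homeo_on W (ball v e) f].
Proof.
move=> /(_ x) [U [V [f [[oU Ux] oV fUV]]]] [oO Ox].
have [oim imP] := homeo_on_restrict oU oV oO fUV.
have [_ cf _] := (homeo_on_open f oU oV).1 fUV.
have : nbhs (f x) (f @` (U `&` O)) 
  by apply: open_nbhs_nbhs; split=> //; exists x.
move=> /nbhs_ballP [e /= e0 eim].
have oUO : open (U `&` O) by exact: openI.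
have oB : open (ball (f x) e) by exact: ball_open.
have oW : open (U `&` O `&` f @^-1` ball (f x) e).
  apply: open_in_preimage => // y; rewrite inE => -[Uy _].
  by apply: cf; rewrite inE.
have [_ cf' [h [hP ch fK hK]]] := (homeo_on_open f oUO oim).1 imP.
exists (U `&` O `&` f @^-1` ball (f x) e), (f x), e, f; split=> //.
- by split=> //; split; [|exact: ballxx].
- by move=> y [[]].
apply/homeo_on_open => //; split; first by move=> y [].
  by move=> y; rewrite inE => -[UOy _]; apply: cf'; rewrite inE.
exists h; split.
- by move=> y By; split; [apply/hP/eim|rewrite /= hK //; exact: eim].
- by move=> y; rewrite inE => By; apply: ch; rewrite inE; exact: eim.
- by move=> y [UOy _]; exact: fK.
- by move=> y By; apply: hK; exact: eim.
Qed.

Lemma ball_segment (R : realType) (V : normedModType R) (v a b : V) (e t : R) :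
  ball v e a -> ball v e b -> 0 <= t <= 1 ->
  ball v e ((1 - t) *: a + t *: b).
Proof.
rewrite -!ball_normE /= => va vb /andP[t0 t1].
have -> : v - ((1 - t) *: a + t *: b) = (1 - t) *: (v - a) + t *: (v - b).
  by rewrite !scalerBr addrACA -opprD -scalerDl subrK scale1r.
apply: le_lt_trans (ler_normD _ _) _; rewrite !normrZ.
rewrite (ger0_norm t0) ger0_norm ?subr_ge0 //.
(* Strictness comes from the summand with coefficient at least one half: [1 - t] in the first case,
   [t] in the second. *)
have [|] := leP t (2^-1); nra.
Qed.

Lemma continuous_segment (R : realType) (V : normedModType R)
    (T : topologicalType) (k : T -> R) (a b : T -> V) :
  continuous k -> continuous a -> continuous b ->
  continuous (fun t => (1 - k t) *: a t + k t *: b t).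
Proof.
move=> ck ca cb t; have ck' : (1 - k u) @[u --> t] --> 1 - k t.
  by apply: cvgB; [exact: cvg_cst|exact: ck].
exact: cvgD (cvgZ ck' (ca t)) (cvgZ (ck t) (cb t)).
Qed.

(** The homotopies may leave [U]: simple connectivity relative to [X] is enough to make holonomy
    inside [U] independent of the path. *)
Definition simple_nbhd (R : realType) (X : topologicalType) (U : set X) :
    Prop :=
  [/\ open U,
      forall y z, U y -> U z -> exists p : ipath R y z, forall t, U (p t) &
      forall y z (p q : ipath R y z),
        (forall t, U (p t)) -> (forall t, U (q t)) -> path_homotopic p q].

Lemma continuous_comp_in (T X Y : topologicalType) (A : set X) (f : X -> Y)
    (h : T -> X) :
  continuous h -> (forall t, A (h t)) -> {in A, continuous f} ->
  continuous (fun t => f (h t)).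
Proof.
move=> ch Ah cf t; apply: (@continuous_comp _ _ _ h f); first exact: ch.
by apply: cf; rewrite inE.
Qed.

(** Convexity of the ball is transported by the chart: segments become paths, and the straight-line
    homotopy joins any two paths with the same ends. *)
Lemma exists_simple_nbhd (R : realType) n (X : topologicalType) (x : X)
    (O : set X) : locally_euclidean R n X -> open_nbhs x O ->
  exists2 W : set X, W x /\ W `<=` O & simple_nbhd R W.
Proof.
move=> lX xO; have [W [v [e [f [e0 [oW Wx] WO]]]]] := chart_ball lX xO.
move=> /(homeo_on_open _ oW (ball_open v e)) [fP cf [g [gP cg fK gK]]].
exists W => //; split=> //.
- move=> y z Wy Wz.
  pose h (t : unit_itv R) := (1 - ival t) *: f y + ival t *: f z.
  have hB t : ball v e (h t).
    exact: ball_segment (fP _ Wy) (fP _ Wz) (ivalP t).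
  have ch : continuous h.
    apply: continuous_segment; first exact: ival_continuous.
      exact: cst_continuous.
    exact: cst_continuous.
  have c0 : g (h zero) = y.
    by rewrite /h ival0 subr0 scale1r scale0r addr0 fK.
  have c1 : g (h one) = z.
    by rewrite /h ival1 subrr scale1r scale0r add0r fK.
  exists (mk_path (continuous_comp_in ch hB cg) c0 c1) => t.
  exact: gP.
- move=> y z p q pW qW.
  have cp := continuous_comp_in (@cts_fun _ _ p) pW cf.
  have cq := continuous_comp_in (@cts_fun _ _ q) qW cf.
  pose h (c : unit_itv R * unit_itv R) :=
    (1 - ival c.2) *: f (p c.1) + ival c.2 *: f (q c.1).
  have hB t : ball v e (h t).
    exact: ball_segment (fP _ (pW _)) (fP _ (qW _)) (ivalP _).
  have ch : continuous h.
    apply: continuous_segment; first exact: ival_snd_continuous.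
      by move=> c; apply: (@continuous_comp _ _ _ fst (fun s => f (p s)));
        [exact: cvg_fst|exact: cp].
    by move=> c; apply: (@continuous_comp _ _ _ fst (fun s => f (q s)));
      [exact: cvg_fst|exact: cq].
  exists (fun c => g (h c)); split.
  + exact: continuous_comp_in ch hB cg.
  + by split=> s; rewrite /h /= ?ival0 ?ival1 ?subr0 ?subrr ?scale1r ?scale0r
      ?addr0 ?add0r fK.
  + split=> t; rewrite /h /= ?path_zero ?path_one -scalerDl subrK scale1r fK //.
      by rewrite -(path_zero (s := p)).
    by rewrite -(path_one (s := p)).
Qed.

(** * Path-connectedness, and connectedness off a countable set *)

Lemma path_connected (R : realType) n (X : topologicalType) (x y : X) :
  locally_euclidean R n X -> connected_space X -> exists p : ipath R x y, True.
Proof.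
move=> lX cX; pose S := [set y | exists p : ipath R x y, True].
have stepS y' z (W : set X) : simple_nbhd R W -> W y' -> W z -> S y' -> S z.
  move=> [_ pW _] Wy Wz [p _]; have [q _] := pW _ _ Wy Wz.
  by exists (concat p q).
suff : S = setT by move=> ST; have : S y by rewrite ST.
have simp z : exists2 W : set X, W z & simple_nbhd R W.
  have [|W [Wz _] sW] := @exists_simple_nbhd R n X z setT lX; last by exists W.
  by split=> //; exact: openT.
apply: cX; first by exists x; exists (const_path R x).
- exists S; rewrite ?setTI // openE => z Sz.
  have [W Wz sW] := simp z; have [oW _ _] := sW.
  rewrite /interior nbhsE; exists W => // w Ww; exact: stepS sW Wz Ww Sz.
- exists S; rewrite ?setTI // -openC openE => z Sz.
  have [W Wz sW] := simp z; have [oW _ _] := sW.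
  rewrite /interior nbhsE; exists W => // w Ww Sw.
  by apply: Sz; exact: stepS sW Ww Wz Sw.
Qed.

Lemma connected_minus_countable (R : realType) (X : topologicalType)
    (A : set X) : locally_euclidean R 2 X -> connected_space X -> countable A ->
  connected (~` A).
Proof.
move=> lX cX cA.
have disk x (O : set X) : open_nbhs x O -> exists W : set X,
    [/\ open_nbhs x W, W `<=` O, connected (W `\` A) & W `\` A !=set0].
  move=> xO; have [W [v [e [f [e0 xW WO]]]]] := chart_ball lX xO.
  have [oW Wx] := xW.
  move=> /(homeo_on_open _ oW (ball_open v e)) [fP cf [g [gP cg fK gK]]].
  have cfA : countable (f @` A) by exact: card_le_trans (card_image_le _ _) cA.
  have [conn [w [Bw Aw]]] := ball_minus_countable v e0 cfA.
  have sub z : (ball v e `\` f @` A) z -> (W `\` A) (g z).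
    move=> [Bz Az]; split; first exact: gP.
    by move=> Agz; apply: Az; exists (g z) => //; exact: gK.
  exists W; split=> //; last by exists (g w); exact: sub.
  (* Values of [f] off [W] are arbitrary, so only the image of the part of [A] in [W] is removed;
     otherwise the image under [g] could be too small. *)
  pose D := ball v e `\` f @` (W `&` A).
  have cWA : countable (f @` (W `&` A)).
    apply: card_le_trans (card_image_le _ _) (card_le_trans _ cA).
    by apply: subset_card_le => ? [].
  have -> : W `\` A = g @` D.
    apply/seteqP; split=> [z [Wz Az]|_ [z [Bz Az] <-]].
      exists (f z); last exact: fK.
      split; first exact: fP.
      by move=> [y [Wy Ay] /(congr1 g)]; rewrite !fK // => yz; rewrite yz in Ay.
    split; first exact: gP.
    move=> Agz; apply: Az; exists (g z); last exact: gK.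
    by split=> //; exact: gP.
  apply: connected_continuous_connected.
    by have [] := ball_minus_countable v e0 cWA.
  by apply: continuous_in_subspaceT => z; rewrite inE => -[Bz _];
    apply: cg; rewrite inE.
move=> B [b Bb] [P oP BP] [F cF BF].
(* A punctured disk is connected, so it lies in [B] or misses it; hence the points
   with a neighbourhood which lies in [B] off [A] form a clopen set. *)
pose S := [set x | exists W, [/\ open_nbhs x W & W `\` A `<=` B]].
have BA : B `<=` ~` A by move=> x; rewrite BP => -[].
have alt W : connected (W `\` A) -> W `\` A `<=` B \/ (W `\` A) `&` B = set0.
  move=> cW; have [->|/set0P WB] := eqVneq ((W `\` A) `&` B) set0.
    by right.
  left.
  rewrite -(cW _ WB); first by move=> x [].
    by exists P => //; rewrite BP setIA setDE -(setIA W) setIid.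
  by exists F => //; rewrite BF setIA setDE -(setIA W) setIid.
have ST : S = setT.
  apply: cX.
  - have [W [bW _ cW _]] := disk b setT (conj openT I).
    exists b, W; split=> //; have [//|WB0] := alt _ cW.
    have : ((W `\` A) `&` B) b by split=> //; split; [exact: bW.2|exact: BA].
    by rewrite WB0.
  - exists S; rewrite ?setTI // openE => x [W [[oW Wx] WB]].
    rewrite /interior nbhsE; exists W => // y Wy; exists W; split=> //.
  - exists S; rewrite ?setTI // -openC openE => x Sx.
    have [W [xW _ cW _]] := disk x setT (conj openT I).
    rewrite /interior nbhsE; exists W => // y Wy [V [[oV Vy] VB]].
    have [WB|WB0] := alt _ cW; first by apply: Sx; exists W.
    (* A disk around [y] inside both sets has a point off [A]; through [V] it lies in [B], against
       [WB0]. *)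
    have [|W' [_ W'VW _ [z [W'z Az]]]] := disk y (V `&` W).
      by split=> //; apply: openI => //; exact: xW.1.
    have [Vz Wz] := W'VW _ W'z.
    have : ((W `\` A) `&` B) z by split=> //; exact: VB.
    by rewrite WB0.
apply/seteqP; split=> // x Ax; have : S x by rewrite ST.
by move=> [W [[oW Wx] WB]]; apply: WB.
Qed.

(** * The covering defined by a cocycle *)

(* The compatibility condition says that the transition functions
   [cocycle_fun i * (cocycle_fun j)^-1] are locally constant. *)
Record cocycle (X : topologicalType) (H : groupType) := Cocycle {
  cocycle_index : Type;
  cocycle_dom : cocycle_index -> set X;
  cocycle_fun : cocycle_index -> X -> H;
  cocycle_dom_open : forall i, open (cocycle_dom i);
  cocycle_dom_cover : forall x, exists i, cocycle_dom i x;
  cocycle_compat : forall i j y, cocycle_dom i y -> cocycle_dom j y ->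
    \forall z \near y, ((cocycle_fun i y)^-1 * cocycle_fun i z =
                        (cocycle_fun j y)^-1 * cocycle_fun j z)%g }.

(** The argument [c] does not affect the set; it ties the type to a topology other than that of the
    product. *)
Definition bundle (X : topologicalType) (H : groupType) (c : cocycle X H) :
  Type := (X * H)%type.

Section bundle_topology.
Context (X : topologicalType) (H : groupType) (c : cocycle X H).
Local Notation E := (bundle c).
Local Notation U := (cocycle_dom (c := c)).
Local Notation g := (cocycle_fun (c := c)).
Local Notation oU := (cocycle_dom_open (c := c)).

HB.instance Definition _ := Choice.copy E (X * H)%type.

(** The label [h] multiplies on the left, so that left translations permute the sheets over each
    domain. *)
Definition sheet (i : cocycle_index c) (h : H) (y : X) : E :=
  (y, (h * g i y)%g).
Definition base (e : E) : X := e.1.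

(** This is the final topology for the sheets over their open domains. *)
Definition bundle_open (O : set E) : Prop :=
  forall i h, open (U i `&` sheet i h @^-1` O).

Local Lemma bundle_openT : bundle_open setT.
Proof. by move=> i h; rewrite preimage_setT setIT; exact: oU. Qed.

Local Lemma bundle_openI : setI_closed bundle_open.
Proof.
move=> A B oA oB i h; rewrite preimage_setI -[U i]setIid setIACA.
by apply: openI; [exact: oA|exact: oB].
Qed.

Local Lemma bundle_openU (J : Type) (f : J -> set E) :
  (forall j, bundle_open (f j)) -> bundle_open (\bigcup_j f j).
Proof.
move=> of_ i h; rewrite preimage_bigcup setI_bigcupr.
by apply: bigcup_open => j _; exact: of_.
Qed.

HB.instance Definition _ :=
  isOpenTopological.Build E bundle_openT bundle_openI bundle_openU.

Lemma bundle_openP (O : set E) :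
  open O <-> forall i h, open (U i `&` sheet i h @^-1` O).
Proof. by []. Qed.

Lemma sheet_continuous i h : {in U i, continuous (sheet i h)}.
Proof. by apply/continuous_inP => [|O oO]; [exact: oU|exact: oO]. Qed.

Lemma base_continuous : continuous base.
Proof.
apply/continuousP => O oO; apply/bundle_openP => i h.
by apply: openI; [exact: oU|].
Qed.

Lemma preimage_base_open W : open W -> open (base @^-1` W).
Proof. by move=> oW; apply: open_comp => // e _; exact: base_continuous. Qed.

Lemma sheetE i (e : E) : sheet i (e.2 * (g i e.1)^-1)%g e.1 = e.
Proof. by case: e => x h; rewrite /sheet /= mulgVK. Qed.

Lemma sheet_inj i h h' y : sheet i h y = sheet i h' y -> h = h'.
Proof. by move=> [/mulIg]. Qed.

(** By compatibility of the cocycle, two sheets that meet at a point agree near it, so one sheet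
    pulls back to an open set along any other. *)
Lemma sheet_open i h (W : set X) :
  open W -> W `<=` U i -> open (sheet i h @` W).
Proof.
move=> oW WU; apply/bundle_openP => j k; rewrite openE => y [Uy [z Wz]].
move=> -[zy]; rewrite {}zy in Wz * => hk; rewrite /interior.
have Wy : nbhs y W by apply: open_nbhs_nbhs.
have Ujy : nbhs y (U j) by apply: open_nbhs_nbhs; split=> //; exact: oU.
have := cocycle_compat (WU _ Wz) Uy.
apply: filterS3 Wy Ujy => z' Wz' Uz' compat; split=> //.
exists z' => //; congr (_, _).
by rewrite -(mulVKg (g i y) (g i z')) compat mulgA hk -mulgA mulVKg.
Qed.

Lemma sheet_homeo i h (W : set X) : open W -> W `<=` U i ->
  homeo_on (sheet i h @` W) W base.
Proof.
move=> oW WU; apply/homeo_on_open => //; first exact: sheet_open.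
split; first by move=> _ [y Wy <-].
  by move=> e _; exact: base_continuous.
exists (sheet i h); split=> //.
- by move=> y; rewrite inE => /WU Uy; apply: sheet_continuous; rewrite inE.
- by move=> _ [y Wy <-].
Qed.

Lemma base_evenly_covered i (W : set X) :
  open W -> W `<=` U i -> evenly_covered base W.
Proof.
move=> oW WU; exists [set sheet i h @` W | h in setT]; split.
- by move=> _ [h _ <-]; exact: sheet_open.
- move=> _ _ [h _ <-] [h' _ <-] [e [[y Wy <-] [y' Wy']]].
  by move=> /[dup] /(congr1 fst) /= -> /sheet_inj ->.
- apply/seteqP; split=> [_ [_ [h _ <-] [y Wy <-]]|e We] //.
  exists (sheet i (e.2 * (g i e.1)^-1)%g @` W); first by eexists.
  by exists e.1 => //; exact: sheetE.
- by move=> _ [h _ <-]; exact: sheet_homeo.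
Qed.

Lemma base_covering : covering_projection base.
Proof.
split; first exact: base_continuous.
  by move=> x _; exists (x, 1%g).
move=> x; have [i Ux] := cocycle_dom_cover c x.
exists (U i); first by split=> //; exact: oU.
by apply: (@base_evenly_covered i) => //; exact: oU.
Qed.

Definition translate (k : H) (e : E) : E := (e.1, (k * e.2)%g).

Lemma translate_continuous k : continuous (translate k).
Proof.
apply/continuousP => O oO; apply/bundle_openP => i h.
rewrite (_ : sheet _ _ @^-1` (translate k @^-1` O) = sheet i (k * h)%g @^-1` O).
  exact: oO.
by apply/funext => y; rewrite /preimage /= /translate /= mulgA.
Qed.

Lemma translateK k : cancel (translate k) (translate k^-1%g).
Proof. by move=> [x h]; rewrite /translate /= mulKg. Qed.

Lemma translateVK k : cancel (translate k^-1%g) (translate k).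
Proof. by move=> [x h]; rewrite /translate /= mulVKg. Qed.

Lemma translate_deck k : deck_transformation base (translate k).
Proof.
split=> //; split; first exact: translate_continuous.
by exists (translate k^-1%g); split;
  [exact: translate_continuous|exact: translateK|exact: translateVK].
Qed.

Lemma base_regular : regular_covering base.
Proof.
split; first exact: base_covering.
move=> [x h] [x' h'] /= xx'; rewrite /base /= in xx'; rewrite -xx'.
exists (exist _ _ (translate_deck (h' * h^-1)%g)).
by rewrite /deck_fun /= /translate /= mulgVK.
Qed.

Lemma preimage_base_dense (A : set X) : dense A -> dense (base @^-1` A).
Proof.
move=> dA O [e Oe] oO; have [i Ue] := cocycle_dom_cover c e.1.
have [|x [[Ux Ox] Ax]] := dA _ _ (oO i (e.2 * (g i e.1)^-1)%g).
  by exists e.1; split=> //; rewrite /preimage /= sheetE.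
by exists (sheet i (e.2 * (g i e.1)^-1)%g x).
Qed.

Lemma preimage_base_countable (A : set X) :
  countable A -> countable [set: H] -> countable (base @^-1` A).
Proof.
move=> cA cH; have := countableX cA cH; apply: sub_countable.
by apply: subset_card_le => -[x h].
Qed.

(** Points over different base points are separated in the base. Two points of one fibre lie on
    sheets with different labels over the same domain, and these are disjoint. *)
Lemma bundle_hausdorff : hausdorff_space X -> hausdorff_space E.
Proof.
rewrite !open_hausdorff => hX e e' ee'.
have [xx'|/hX [[P Q] /= [Pe Qe] [oP oQ PQ]]] := eqVneq e.1 e'.1; last first.
  exists (base @^-1` P, base @^-1` Q); rewrite /= ?inE in Pe Qe * => //.
  split; [exact: preimage_base_open|exact: preimage_base_open|].
  by rewrite -preimage_setI (eqP PQ) preimage_set0.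
have [i Ue] := cocycle_dom_cover c e.1.
pose s (e : E) := (e.2 * (g i e.1)^-1)%g.
exists (sheet i (s e) @` U i, sheet i (s e') @` U i) => /=.
  rewrite !inE; split; first by exists e.1; rewrite // sheetE.
  by exists e'.1; rewrite -?xx' // xx' sheetE.
split; [by apply: sheet_open => //; exact: oU..|].
apply/eqP/seteqP; split=> // f [[y Uy <-] [y' _]].
move=> /[dup] /(congr1 fst) /= -> /sheet_inj ss'.
by case/eqP: ee'; rewrite -(sheetE i e) -(sheetE i e') -/(s e) -/(s e') ss' xx'.
Qed.

Lemma bundle_locally_euclidean (R : realType) n :
  locally_euclidean R n X -> locally_euclidean R n E.
Proof.
move=> lX e; have [i Ue] := cocycle_dom_cover c e.1.
have [|W [v [r [f [r0 [oW We] WU]]]]] := @chart_ball R n X e.1 (U i) lX.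
  by split=> //; exact: oU.
set h := (e.2 * (g i e.1)^-1)%g.
move=> /(homeo_on_open _ oW (ball_open v r)) [fP cf [f' [f'P cf' fK f'K]]].
have oS : open (sheet i h @` W) by exact: sheet_open.
exists (sheet i h @` W), (ball v r), (f \o base); split.
- by split=> //; exists e.1 => //; exact: sheetE.
- exact: ball_open.
apply/homeo_on_open => //; first exact: ball_open.
split.
- by move=> _ [y Wy <-]; exact: fP.
- move=> e'; rewrite inE => -[y Wy <-]; apply: continuous_comp.
    exact: base_continuous.
  by apply: cf; rewrite inE.
exists (sheet i h \o f'); split.
- by move=> w Bw; exists (f' w) => //; exact: f'P.
- move=> w; rewrite inE => Bw; apply: continuous_comp.
    by apply: cf'; rewrite inE.
  by apply: sheet_continuous; rewrite inE; apply/WU/f'P.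
- by move=> _ [y Wy <-] /=; rewrite /base /= fK.
- by move=> w Bw; rewrite /= /base /= f'K.
Qed.

End bundle_topology.

(** * Paracompactness of the total space *)

Lemma filter_finite_bigI (T : Type) (I : choiceType) (F : set_system T)
    (D : set I) (f : I -> set T) : Filter F -> finite_set D ->
  (forall i, D i -> F (f i)) -> F (\bigcap_(i in D) f i).
Proof. by move=> FF /finite_fsetP [D' ->] Ff; exact: filter_bigI. Qed.

(** Refine the cover by open sets that lie in [U] or whose closure misses [x]. Near [x] only
    finitely many members matter; removing the closures that miss [x] leaves a neighbourhood met
    only by members inside [U]. *)
Lemma paracompact_regular (X : topologicalType) (x : X) (U : set X) :
  paracompact X -> open_nbhs x U ->
  exists2 V, open_nbhs x V & closure V `<=` U.
Proof.
move=> [hX pX] [oU Ux].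
have [|V [[oV cV] lV rV]] :=
    pX [set W | open W /\ (W `<=` U \/ ~ closure W x)].
  split; first by move=> W [].
  apply/seteqP; split=> // y _; have [<-|xy] := eqVneq x y.
    by exists U => //; split=> //; left.
  move: hX; rewrite open_hausdorff => /(_ _ _ xy) [[P Q] /= [Px Qy]].
  rewrite !inE in Px Qy; move=> [oP oQ /eqP PQ0].
  exists Q => //; split=> //; right=> /(_ P) [|z [Qz Pz]].
    exact: open_nbhs_nbhs.
  by have : (P `&` Q) z by []; rewrite PQ0.
have [N xN fN] := lV x.
pose D := [set v | (V v /\ v `&` N !=set0) /\ ~ closure v x].
have fD : finite_set D by apply: sub_finite_set fN => v [].
pose M := N `&` \bigcap_(v in D) ~` closure v.
have xM : nbhs x M.
  apply: filterI => //; apply: filter_finite_bigI fD _ => v [_ xv].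
  by apply: open_nbhs_nbhs; split=> //; exact/closed_openC/closed_closure.
exists M°; first by split; [exact: open_interior|exact: xM].
move=> y cMy; have [v Vv vy] : (\bigcup_(v in V) v) y by rewrite cV.
have [|z [Mz vz]] := cMy v.
  by apply: open_nbhs_nbhs; split=> //; exact: oV.
have {Mz} [Nz Dz] := interior_subset Mz.
have [w [ow [wU|wx]] vw] := rV _ Vv; first exact/wU/vw.
exfalso; apply: (Dz v); last exact: subset_closure.
split; first by split=> //; exists z.
by move/(closureS vw).
Qed.

Section bundle_paracompact.
Context (X : topologicalType) (H : groupType) (c : cocycle X H).
Local Notation E := (bundle c).
Local Notation U := (cocycle_dom (c := c)).
Local Notation g := (cocycle_fun (c := c)).
Local Notation oU := (cocycle_dom_open (c := c)).
Local Notation fiber i e := ((e.2 * (g i e.1)^-1)%g).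

(** Closures are required inside the domains so that a point outside the domain chosen for [v] has a
    neighbourhood missing every sheet over [v]. *)
Lemma shrunk_cover : paracompact X -> exists V : set (set X),
  [/\ open_covering V, locally_finite V &
      forall v, V v -> exists i, closure v `<=` U i].
Proof.
move=> pX; have [_ refX] := pX.
have [|V [cV lV rV]] :=
    refX [set W | open W /\ exists i, closure W `<=` U i].
  split; first by move=> W [].
  apply/seteqP; split=> // x _; have [i Ux] := cocycle_dom_cover c x.
  have [|W [oW Wx] WU] := @paracompact_regular X x (U i) pX.
    by split=> //; exact: oU.
  by exists W => //; split=> //; exists i.
exists V; split=> // v /rV [w [_ [i wU]] vw].
by exists i; apply: subset_trans wU; exact: closureS.
Qed.

(** The sheet is usable only over [U i], but paracompactness wants a cover of all of [X]: the
    complement of [closure v] fills the rest, where no condition is imposed. *)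
Lemma sheet_cover (O : set (set E)) (v : set X) i h :
  paracompact X -> open_covering O -> closure v `<=` U i ->
  exists W : set (set X), [/\ open_covering W, locally_finite W &
    forall w, W w -> w `&` v !=set0 ->
      w `<=` U i /\ exists2 u, O u & sheet i h @` w `<=` u].
Proof.
move=> [_ refX] [oO cO] vU.
have [|W [cW lW rW]] := refX [set w | open w /\ (w `&` v !=set0 ->
    w `<=` U i /\ exists2 u, O u & sheet i h @` w `<=` u)].
  split; first by move=> w [].
  apply/seteqP; split=> // x _.
  have [cvx|cvx] := pselect (closure v x); last first.
    exists (~` closure v) => //; split; first exact/closed_openC/closed_closure.
    by move=> [z [cvz vz]]; case: cvz; exact: subset_closure.
  have [u Ou ux] : (\bigcup_(u in O) u) (sheet i h x) by rewrite cO.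
  exists (U i `&` sheet i h @^-1` u); last by split=> //; exact: vU.
  split; first by apply: (bundle_openP _).1; exact: oO.
  move=> _; split; first by move=> y [].
  by exists u => // _ [y [_ uy] <-].
exists W; split=> // w /rW [w' [_ w'P] ww'] [z [wz vz]].
have [|w'U [u Ou w'u]] := w'P; first by exists z; split=> //; exact: ww'.
split; first exact: subset_trans w'U.
by exists u => // _ [y wy <-]; apply: w'u; exists y => //; exact: ww'.
Qed.

(* The refinement is lifted sheet by sheet over a locally finite cover [V] of
   the base whose closures trivialise the cocycle; near a point, only one sheet
   over each of the finitely many relevant members of [V] matters. *)
Lemma bundle_paracompact : paracompact X -> paracompact E.
Proof.
move=> pX; split; first exact: bundle_hausdorff pX.1.
(* An inhabitant provides the default index [i0] for the choice of [idx] outside [V]. *)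
move=> O cO; have [[e0]|noE] := pselect (inhabited E); last first.
  exists set0; split=> //; last by move=> e; case: noE.
  by split=> //; apply/seteqP; split=> // e; case: noE.
have [i0 _] := cocycle_dom_cover c e0.1.
have [V [[oV cV] lV VU]] := shrunk_cover pX.
have [idx idxP] : {idx & forall v, V v -> closure v `<=` U (idx v)}.
  apply: (choice (P := fun v i => V v -> closure v `<=` U i)) => v.
  have [/VU [i vi]|nV] := pselect (V v); first by exists i.
  by exists i0.
(* The refinement depends on [h] as well as on [v], since [O] need not be invariant under
   translations. *)
have [W WP] : {W : set X * H -> set (set X) & forall vh, V vh.1 ->
    [/\ open_covering (W vh), locally_finite (W vh) &
     forall w, W vh w -> w `&` vh.1 !=set0 -> w `<=` U (idx vh.1) /\
       exists2 u, O u & sheet (idx vh.1) vh.2 @` w `<=` u]}.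
  apply: (choice (P := fun vh (W : set (set X)) => V vh.1 ->
    [/\ open_covering W, locally_finite W &
     forall w, W w -> w `&` vh.1 !=set0 -> w `<=` U (idx vh.1) /\
       exists2 u, O u & sheet (idx vh.1) vh.2 @` w `<=` u])) => -[v h].
  have [Vv|nV] := pselect (V v); last by exists set0.
  by have [W WP] := sheet_cover h pX cO (idxP _ Vv); exists W.
pose lift v h w := sheet (idx v) h @` (w `&` v).
pose S v := [set s | exists h w,
  [/\ W (v, h) w, w `&` v !=set0 & s = lift v h w]].
exists (\bigcup_(v in V) S v); split.
- split.
    move=> _ [v Vv [h [w [Ww wv ->]]]].
    have [[oW _] _ rW] := WP (v, h) Vv.
    apply: sheet_open; first by apply: openI; [exact: oW|exact: oV].
    by move=> y [wy _]; have [wU _] := rW _ Ww wv; exact: wU.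
  apply/seteqP; split=> // e _.
  have [v Vv ve] : (\bigcup_(v in V) v) e.1 by rewrite cV.
  set h := fiber (idx v) e.
  have [[_ cW] _ _] := WP (v, h) Vv.
  have [w Ww we] : (\bigcup_(w in W (v, h)) w) e.1 by rewrite cW.
  exists (lift v h w); last by exists e.1 => //; exact: sheetE.
  by exists v => //; exists h, w; split=> //; exists e.1.
- move=> e; have [N eN fN] := lV e.1.
  have lSv v : V v -> exists2 M, nbhs e M &
      finite_set [set s | S v s /\ s `&` M !=set0].
    move=> Vv; set i := idx v; have [Ue|Ue] := pselect (U i e.1); last first.
      exists (base (c := c) @^-1` ~` closure v).
        apply: open_nbhs_nbhs; split; last by move/(idxP _ Vv).
        by apply: preimage_base_open; exact/closed_openC/closed_closure.
      apply: sub_finite_set (finite_set0 _) => s [[h [w [_ _ ->]]]].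
      by move=> [_ [[y [_ vy] <-]]]; apply; exact: subset_closure.
    set h := fiber i e; have [_ lW _] := WP (v, h) Vv.
    have [N' eN' fN'] := lW e.1.
    exists (sheet i h @` (N'° `&` U i)).
      apply: open_nbhs_nbhs; split.
        apply: sheet_open; last by move=> y [].
        by apply: openI; [exact: open_interior|exact: oU].
      by exists e.1; [split|exact: sheetE].
    apply: sub_finite_set (finite_image (lift v h) fN') => s.
    move=> [[h' [w [Ww _ ->]]]] [_ [[y [wy vy] <-] [y' [N'y _]]]].
    move=> /[dup] /(congr1 fst) /= yy'; rewrite yy' in N'y * => /sheet_inj hh'.
    rewrite -hh' in Ww *; exists w => //; split=> //.
    by exists y; split=> //; exact: interior_subset.
  have [M MP] : {M : set X -> set E & forall v, V v ->
      nbhs e (M v) /\ finite_set [set s | S v s /\ s `&` M v !=set0]}.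
    apply: (choice (P := fun v (M : set E) => V v ->
      nbhs e M /\ finite_set [set s | S v s /\ s `&` M !=set0])) => v.
    have [/lSv [M ? ?]|nV] := pselect (V v).
      by exists M.
    by exists setT.
  pose D := [set v | V v /\ v `&` N !=set0].
  exists (base (c := c) @^-1` N `&` \bigcap_(v in D) M v).
    apply: filterI; first exact: base_continuous.
    by apply: filter_finite_bigI fN _ => v [/MP []].
  apply: sub_finite_set (bigcup_finite fN (fun v Dv => (MP v Dv.1).2)) => s.
  move=> [[v Vv Svs] [f [sf [Nf Mf]]]].
  have Dv : D v.
    split=> //; move: Svs => [h [w [_ _ sE]]]; rewrite sE in sf.
    by case: sf => y [_ vy] yf; exists y; split=> //; rewrite -yf in Nf.
  by exists v => //; split=> //; exists f; split=> //; exact: Mf.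
- move=> _ [v Vv [h [w [Ww wv ->]]]]; have [_ _ rW] := WP (v, h) Vv.
  have [_ [u Ou wu]] := rW _ Ww wv.
  by exists u => // _ [y [wy _] <-]; apply: wu; exists y.
Qed.

End bundle_paracompact.

(** * Pieces of paths, holonomy and path lifting *)

Section path_pieces.
Context (R : realType) (X : topologicalType) (x y : X) (p : ipath R x y).
Local Notation I := (unit_itv R).

Definition segment_fun (a b : I) (s : I) : X :=
  p (iproj ((1 - ival s) * ival a + ival s * ival b)).

Let affine_continuous (T : topologicalType) (k : T -> R) (a b : R) :
  continuous k -> continuous (fun r => (1 - k r) * a + k r * b).
Proof.
move=> ck; apply: (@continuous_segment R R T k (cst a) (cst b)) => //;
  exact: cst_continuous.
Qed.

Local Lemma segment_continuous a b : continuous (segment_fun a b).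
Proof.
by apply: ext_continuous; apply: affine_continuous; exact: ival_continuous.
Qed.

Local Lemma segment_zero a b : segment_fun a b zero = p a.
Proof. by rewrite /segment_fun ival0 subr0 mul1r mul0r addr0 ivalK. Qed.

Local Lemma segment_one a b : segment_fun a b one = p b.
Proof. by rewrite /segment_fun ival1 subrr mul1r mul0r add0r ivalK. Qed.

Definition segment (a b : I) : ipath R (p a) (p b) :=
  mk_path (@segment_continuous a b) (segment_zero a b) (segment_one a b).

(** No order of [a], [b], [d] is assumed: both sides run through [p] along real functions with the
    same end values, and these are joined linearly. *)
Lemma segment_concat a b d :
  path_homotopic (segment a d) (concat (segment a b) (segment b d)).
Proof.
pose v (s : R) := if s <= 2^-1 then (1 - 2 * s) * ival a + 2 * s * ival b
  else (1 - (2 * s - 1)) * ival b + (2 * s - 1) * ival d.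
have cid : continuous (fun s : R => s) by move=> s; exact: cvg_id.
have c2 : continuous (fun s : R => 2 * s).
  by move=> s; apply: cvgM; [exact: cvg_cst|exact: cid].
have c21 : continuous (fun s : R => 2 * s - 1).
  by move=> s; apply: cvgB; [exact: c2|exact: cvg_cst].
apply: (@reparam_homotopic R X (fun s => (1 - s) * ival a + s * ival d) v
  (fun r => p (iproj r))).
- exact: ext_continuous.
- exact: affine_continuous.
- apply: continuous_if_le => //.
  + exact: affine_continuous.
  + exact: affine_continuous.
  + by move=> s ->; lra.
- by rewrite /v half_ge0; lra.
- by rewrite /v half_lt1; lra.
- by move=> s s01; rewrite /= /mk_path /segment_fun iprojK.
- move=> s s01; rewrite concat_iproj // /v; case: ifPn; rewrite -?ltNge => s2.
    by rewrite /= /mk_path /segment_fun iprojK //; lra.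
  by rewrite /= /mk_path /segment_fun iprojK //; lra.
Qed.

End path_pieces.

Lemma concat_in (R : realType) (X : topologicalType) (W : set X) (x y z : X)
    (p : ipath R x y) (q : ipath R y z) :
  (forall t, W (p t)) -> (forall t, W (q t)) -> forall t, W (concat p q t).
Proof. by move=> Wp Wq t; rewrite concatE; case: ifP. Qed.

Lemma unit_itv_connected (R : realType) : connected [set: unit_itv R].
Proof.
have -> : [set: unit_itv R] = @iproj R @` setT.
  by apply/seteqP; split=> // t _; exists (ival t) => //; exact: ivalK.
apply: connected_continuous_connected; last first.
  by apply: continuous_subspaceT; exact: iproj_continuous.
by apply/connected_intervalP => a b _ _ c.
Qed.

(** Agreement is tested through [q], so that a ball of the real line can serve as neighbourhood for
    maps on the unit interval. *)
Lemma continuous_at_near_eq (T Y Z : topologicalType) (q : T -> Z)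
    (f g : T -> Y) (t : T) (B : set Z) :
  {for t, continuous q} -> nbhs (q t) B -> (forall u, B (q u) -> f u = g u) ->
  {for t, continuous f} -> {for t, continuous g}.
Proof.
move=> cq qB fg cf; rewrite /prop_for /continuous_at.
have <- : f t = g t by apply: fg; exact: nbhs_singleton.
apply: cvg_trans cf; apply: near_eq_cvg.
have : \forall u \near t, B (q u) by exact: cq _ qB.
by apply: filterS => u; exact: fg.
Qed.

Section holonomy.
Context (R : realType) (X : topologicalType) (x0 : X) (H : groupType).
Context (gam : forall x, ipath R x0 x) (phi : {multiplicative pi1 R x0 -> H}).
Implicit Types x y z : X.

Definition hol x y (p : ipath R x y) : H :=
  phi (loop_class (concat (concat (gam x) p) (reverse (gam y)))).

Lemma hol_homotopic x y (p q : ipath R x y) :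
  path_homotopic p q -> hol p = hol q.
Proof.
move=> pq; congr (phi _); apply/loop_classP.
by do ![apply: concat_homotopic|exact: path_homotopic_refl|].
Qed.

(** Endpoints are part of the type of a path, so pieces ending at [p zero] or [p one] must be
    compared with paths typed by [x] and [y]. *)
Lemma hol_eq x y x' y' (p : ipath R x y) (q : ipath R x' y') :
  p =1 q -> hol p = hol q.
Proof.
move=> pq; have xx' : x = x' by rewrite -(path_zero (s := p)) pq path_zero.
have yy' : y = y' by rewrite -(path_one (s := p)) pq path_one.
by case: _ / xx' in q pq *; case: _ / yy' in q pq *; congr hol; apply/path_eqP.
Qed.

Lemma concatVKp_homotopic x y z (p : ipath R x y) (q : ipath R x z) :
  path_homotopic (concat p (concat (reverse p) q)) q.
Proof.
apply: path_homotopic_trans (concatA_homotopic _ _ _) _.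
apply: path_homotopic_trans (concat1p_homotopic q).
apply: concat_homotopic (path_homotopic_refl _); exact: concatpV_homotopic.
Qed.

Lemma concatKp_homotopic x y z (p : ipath R y x) (q : ipath R x z) :
  path_homotopic (concat (reverse p) (concat p q)) q.
Proof.
apply: path_homotopic_trans (concatA_homotopic _ _ _) _.
apply: path_homotopic_trans (concat1p_homotopic q).
apply: concat_homotopic (path_homotopic_refl _); exact: concatVp_homotopic.
Qed.

(** Closing up both factors inserts [reverse (gam y)] followed by [gam y] between them, and this
    cancels. *)
Lemma hol_concat x y z (p : ipath R x y) (q : ipath R y z) :
  hol (concat p q) = (hol p * hol q)%g.
Proof.
rewrite /hol -gmulfM; congr (phi _); rewrite [RHS]pi1_mulE; apply/loop_classP.
apply: path_homotopic_sym.
apply: path_homotopic_trans (path_homotopic_sym (concatA_homotopic _ _ _)) _.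
apply: (@path_homotopic_trans _ _ _ _ _
  (concat (concat (gam x) p) (concat q (reverse (gam z))))).
  apply: concat_homotopic; first exact: path_homotopic_refl.
  apply: path_homotopic_trans _ (concatKp_homotopic (gam y) _).
  apply: concat_homotopic; first exact: path_homotopic_refl.
  by apply: path_homotopic_sym; exact: concatA_homotopic.
apply: path_homotopic_trans (concatA_homotopic _ _ _) _.
apply: concat_homotopic; last exact: path_homotopic_refl.
by apply: path_homotopic_sym; exact: concatA_homotopic.
Qed.

Lemma hol_const x : hol (const_path R x) = 1%g.
Proof.
(* The constant path is idempotent up to homotopy, and an idempotent of a group is trivial. *)
apply: (@mulgI _ (hol (const_path R x))); rewrite -hol_concat mulg1.
by apply: hol_homotopic; exact: concat1p_homotopic.
Qed.

Lemma hol_surj x y : (forall k, exists a, phi a = k) ->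
  forall k, exists p : ipath R x y, hol p = k.
Proof.
move=> phi_surj k; have [a <-] := phi_surj k; have [s ->] := loop_class_surj a.
exists (concat (reverse (gam x)) (concat s (gam y))).
congr (phi _); apply/loop_classP.
apply: (@path_homotopic_trans _ _ _ _ _
  (concat (concat s (gam y)) (reverse (gam y)))).
  apply: concat_homotopic (concatVKp_homotopic _ _) (path_homotopic_refl _).
apply: path_homotopic_trans (path_homotopic_sym (concatA_homotopic _ _ _)) _.
apply: path_homotopic_trans (concatp1_homotopic s).
apply: concat_homotopic (path_homotopic_refl _) _; exact: concatpV_homotopic.
Qed.

Context (N : X -> set X) (N_self : forall x, N x x).
Context (N_simple : forall x, simple_nbhd R (N x)).
Context (N_base : forall x O, open_nbhs x O ->
  exists2 W : set X, W x /\ W `<=` O & simple_nbhd R W).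

(** A path inside [N x] exists exactly when [y] lies in [N x]; the value [1] is a filler
    elsewhere. *)
Definition hol_local x y : H :=
  if pselect (exists p : ipath R x y, forall t, N x (p t)) is left px
  then hol (projT1 (cid px)) else 1%g.

Lemma hol_localE x y (p : ipath R x y) :
  (forall t, N x (p t)) -> hol_local x y = hol p.
Proof.
move=> Np; rewrite /hol_local; case: pselect => [px|]; last by case; exists p.
case: (cid px) => q Nq /=; apply: hol_homotopic.
by have [_ _ sN] := N_simple x; exact: sN.
Qed.

Lemma hol_local_step x y z (q : ipath R y z) : N x y ->
  (forall t, N x (q t)) -> hol_local x z = (hol_local x y * hol q)%g.
Proof.
move=> Ny Nq; have [_ pN _] := N_simple x.
have [p Np] := pN _ _ (N_self x) Ny.
by rewrite (hol_localE (concat_in Np Nq)) hol_concat (hol_localE Np).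
Qed.

(** Both sides are the holonomy of one path from [y] to [z] that stays in both neighbourhoods. *)
Lemma hol_local_compat i j y : N i y -> N j y ->
  \forall z \near y, ((hol_local i y)^-1 * hol_local i z =
                      (hol_local j y)^-1 * hol_local j z)%g.
Proof.
move=> Niy Njy; have [oi _ _] := N_simple i; have [oj _ _] := N_simple j.
have [|W [Wy WN] [oW pW _]] := @N_base y (N i `&` N j).
  by split; [exact: openI|split].
rewrite /prop_near1 nbhsE; exists W => // z Wz.
have [q Wq] := pW _ _ Wy Wz => /=.
rewrite (hol_local_step Niy (fun t => (WN _ (Wq t)).1)).
by rewrite (hol_local_step Njy (fun t => (WN _ (Wq t)).2)) !mulKg.
Qed.

Lemma hol_local_open x : open (N x).
Proof. by have [] := N_simple x. Qed.

Definition hol_cocycle : cocycle X H := Cocycle (cocycle_dom := N)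
  hol_local_open (fun x => ex_intro (fun i => N i x) x (N_self x))
  hol_local_compat.

Local Notation E := (bundle hol_cocycle).

Section lift.
Context (x y : X) (p : ipath R x y) (h : H).

Definition lift_path (t : unit_itv R) : E :=
  (p t, h * hol (segment p zero t))%g.

(** Near [t] the lift stays on the sheet over [N (p t)] through [lift_path t], where it is [p]
    followed by that sheet. *)
Lemma lift_path_continuous_at (t : unit_itv R) : continuous_at t lift_path.
Proof.
set W := N (p t); set k := (h * hol (segment p zero t))%g.
have oW : open W := hol_local_open (p t).
have cs : {for t, continuous (fun u => sheet (c := hol_cocycle) (p t) k (p u))}.
  apply: (@continuous_comp _ _ _ p (sheet (c := hol_cocycle) (p t) k)).
    exact: cts_fun.
  by apply: sheet_continuous; rewrite inE; exact: N_self.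
have : nbhs (ival t) (fun r => W (p (iproj r))).
  apply: (@ext_continuous R X R x y p id).
    by move=> r; exact: cvg_id.
  by rewrite ivalK; apply: open_nbhs_nbhs; split=> //; exact: N_self.
move=> /nbhs_ballP [e /= e0 eW].
apply: (@continuous_at_near_eq _ _ _ (@ival R) _ _ t (ball (ival t) e)
  _ _ _ cs).
- exact: ival_continuous.
- exact: nbhsx_ballx.
move=> u tu; congr (_, _).
(* The ball is convex, so the whole piece of [p] between [t] and [u] stays in [W]. *)
have segW s : W (segment p t u s).
  apply: eW; apply: ball_segment (ivalP s) => //; exact: ballxx.
rewrite /= (hol_localE segW) /k -mulgA -hol_concat; congr (_ * _)%g.
by apply: hol_homotopic; apply: path_homotopic_sym; exact: segment_concat.
Qed.

Lemma lift_path_continuous : continuous lift_path.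
Proof. exact: lift_path_continuous_at. Qed.

End lift.

Lemma clopen_hol (S : set E) x y (p : ipath R x y) h :
  open S -> closed S -> S (x, h) -> S (y, (h * hol p)%g).
Proof.
move=> oS cS Sx.
have -> : (y, (h * hol p)%g) = lift_path p h one.
  rewrite /lift_path; congr (_, (_ * _)%g); first by rewrite path_one.
  apply: hol_eq => s.
  by rewrite /= /mk_path /segment_fun ival0 ival1 mulr0 add0r mulr1 ivalK.
have S0 : S (lift_path p h zero).
  rewrite (_ : lift_path p h zero = (x, h)) //.
  rewrite /lift_path; congr (_, _); first by rewrite path_zero.
  rewrite -[RHS]mulg1 -(hol_const (p zero)); congr (_ * _)%g.
  apply: hol_eq => s.
  by rewrite /= /mk_path /segment_fun ival0 !mulr0 addr0.
have cl := @lift_path_continuous _ _ p h.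
have : (lift_path p h @^-1` S) one.
  rewrite (@unit_itv_connected R (lift_path p h @^-1` S)) //.
  - by exists zero.
  - exists (lift_path p h @^-1` S); rewrite ?setTI //.
    by apply: open_comp => // t _; exact: cl.
  - exists (lift_path p h @^-1` S); rewrite ?setTI //.
    by apply: closed_comp => // t _; exact: cl.
by [].
Qed.

Lemma hol_bundle_connected :
  (forall k, exists a, phi a = k) -> connected_space E.
Proof.
move=> phi_surj S [[x h] Sxh] [P oP SP] [C cC SC].
rewrite setTI in SP; rewrite setTI in SC.
apply/seteqP; split=> // -[y k] _.
have [p holp] := hol_surj x y phi_surj (h^-1 * k)%g.
rewrite -(mulVKg h k) -holp; apply: clopen_hol => //; first by rewrite SP.
by rewrite SC.
Qed.

End holonomy.

(** * Restriction of coverings to punctured spaces *)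

Lemma connected_set_type (T : topologicalType) (A : set T) :
  connected A -> connected [set: set_type A].
Proof.
move=> cA B [b Bb] [P oP BP] [C cC BC].
rewrite setTI in BP; rewrite setTI in BC.
have [Q oQ QP] : open P by [].
have [F oF FC] : open (~` C) by exact/closed_openC.
suff imB : set_val @` B = A.
  apply/seteqP; split=> // x _.
  have : (set_val @` B) (set_val x) by rewrite imB; exact: set_valP.
  by move=> [y By /val_inj <-].
apply: cA; first by exists (set_val b), b.
- exists Q => //; apply/seteqP; split=> [_ [x Bx <-]|x [Ax Qx]].
    by split; [exact: set_valP|rewrite BP -QP in Bx].
  exists (exist _ x (mem_set Ax)) => //.
  by rewrite BP -QP.
- exists (~` F); first exact/open_closedC.
  have BF x : B x <-> ~ F (set_val x).
    by rewrite BC -(setCK C) -FC.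
  apply/seteqP; split=> [_ [x /BF Fx <-]|x [Ax Fx]].
    by split=> //; exact: set_valP.
  by exists (exist _ x (mem_set Ax)) => //; exact/BF.
Qed.

Lemma perforatedP (X : topologicalType) (A : set X) (x : perforated A) :
  ~ A (set_val x).
Proof. exact: set_valP x. Qed.

Definition perforate (X : topologicalType) (A : set X) (x : X) (nAx : ~ A x) :
  perforated A := exist _ x (mem_set nAx).

Section puncture.
Context (E X : topologicalType) (A0 : set E) (A : set X) (f : E -> X).
Hypothesis fP : forall x, ~ A0 x -> ~ A (f x).

Definition puncture (x : perforated A0) : perforated A :=
  perforate (fP (@perforatedP _ _ x)).

Lemma puncture_continuous : continuous f -> continuous puncture.
Proof.
move=> cf; apply/continuousP => _ [B oB <-].
by exists (f @^-1` B) => //; apply: open_comp => // x _; exact: cf.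
Qed.

End puncture.

Section puncture_covering.
Context (E X : topologicalType) (A : set X) (p : E -> X).
Local Notation A0 := (p @^-1` A).
Local Notation p0 := (@puncture E X A0 A p (fun _ nAx => nAx)).

Lemma puncture_surj : set_surj setT setT p ->
  forall y : perforated A, exists x : perforated A0, p (set_val x) = set_val y.
Proof.
move=> sp y; have [x _ xy] := sp (set_val y) I.
have A0x : (~` A0) x by rewrite /preimage /= /setC /= xy; exact: perforatedP.
by exists (perforate A0x).
Qed.

Lemma puncture_evenly_covered (U : set X) : open U -> set_surj setT setT p ->
  evenly_covered p U -> evenly_covered p0 (set_val @^-1` U).
Proof.
move=> oU sp [S [oS tS cS hS]].
have oval (Y : topologicalType) (D : set Y) (B : set Y) : open B ->
    open (set_val @^-1` B : set (perforated D)).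
  by move=> oB; exists B.
exists [set set_val @^-1` V | V in S]; split.
- by move=> _ [V SV <-]; apply: oval; exact: oS.
- move=> _ _ [V SV <-] [W SW <-] [x [Vx Wx]].
  by rewrite (tS V W) //; exists (set_val x).
- apply/seteqP; split=> [x [_ [V SV <-] Vx]|x Ux].
    by rewrite /preimage /=; have : (\bigcup_(V in S) V) (set_val x);
      [exists V|rewrite cS].
  have [V SV Vx] : (\bigcup_(V in S) V) (set_val x) by rewrite cS.
  by exists (set_val @^-1` V) => //; exists V.
- move=> _ [V SV <-].
  have [pVU cp [g [gUV cg pK gK]]] :=
    (homeo_on_open p (oS _ SV) oU).1 (hS _ SV).
  (* The local inverse must be a total map into the punctured space; off [U] surjectivity of [p]
     supplies some value. *)
  have [g0 g0P] : {g0 : perforated A -> perforated A0 & forall y,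
      U (set_val y) -> set_val (g0 y) = g (set_val y)}.
    apply: (choice (P := fun (y : perforated A) (x : perforated A0) =>
      U (set_val y) -> set_val x = g (set_val y))) => y.
    have [Uy|nUy] := pselect (U (set_val y)).
      have A0g : (~` A0) (g (set_val y)).
        by rewrite /preimage /setC /= gK //; exact: perforatedP.
      by exists (perforate A0g).
    by have [x _] := puncture_surj sp y; exists x.
  apply/homeo_on_open; [exact/oval/oS|exact: oval|split].
  + by move=> x Vx; exact: pVU.
  + apply/continuous_inP; first exact/oval/oS.
    move=> _ [B oB <-].
    exact: (oval _ A0 _ (open_in_preimage (oS _ SV) cp oB)).
  exists g0; split.
  + by move=> y Uy; rewrite /preimage /= g0P //; exact: gUV.
  + apply/continuous_inP; first exact: oval.
    move=> _ [B oB <-].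
    rewrite (_ : _ `&` _ = set_val @^-1` (U `&` g @^-1` B)).
      by apply: oval; exact: open_in_preimage.
    by apply/seteqP; split=> y [Uy By]; split=> //; move: By;
      rewrite /preimage /= g0P.
  + move=> x Vx; apply: val_inj; rewrite [LHS]g0P; last exact: pVU.
    exact: pK.
  + by move=> y Uy; apply: val_inj; rewrite /= g0P //; exact: gK.
Qed.

Lemma puncture_covering : covering_projection p -> covering_projection p0.
Proof.
move=> [cp sp ep]; split; first exact: puncture_continuous.
  move=> y _; have [x xy] := puncture_surj sp y.
  by exists x => //; exact: val_inj.
move=> y; have [U [oU Uy] eU] := ep (set_val y).
exists (set_val @^-1` U); first by split=> //; exists U.
exact: puncture_evenly_covered.
Qed.

Lemma puncture_deck (d : deck p) :
  exists d0 : deck p0, forall x, set_val (d0 x) = d (set_val x).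
Proof.
case: d => f [[cf [g [cg fK gK]]] pf] /=.
have pfE x : p (f x) = p x := congr1 (fun q => q x) pf.
have pgE x : p (g x) = p x by rewrite -pfE gK.
have fP x : ~ A0 x -> ~ A0 (f x) by rewrite /preimage /= pfE.
have gP x : ~ A0 x -> ~ A0 (g x) by rewrite /preimage /= pgE.
have Pf : deck_transformation p0 (puncture fP).
  split; last first.
    by apply/funext => x; apply: val_inj; exact: pfE.
  split; first exact: puncture_continuous.
  exists (puncture gP); split; first exact: puncture_continuous.
    by move=> x; apply: val_inj; exact: fK.
  by move=> x; apply: val_inj; exact: gK.
by exists (exist _ _ Pf).
Qed.

Lemma puncture_regular : regular_covering p -> regular_covering p0.
Proof.
move=> [cp rp]; split; first exact: puncture_covering.
move=> x y /(congr1 set_val) /= pxy; have [d dxy] := rp _ _ pxy.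
have [d0 d0P] := puncture_deck d.
by exists d0; apply: val_inj; rewrite [LHS]d0P.
Qed.

End puncture_covering.

(** * The deck group of the punctured covering, and the conclusion *)

(** The evident homomorphism goes from [H] to deck transformations, by translation, so the
    isomorphism is obtained as its inverse. *)
Lemma group_isomorphic_bij (G K : groupType) (T : K -> G) :
  {morph T : x y / (x * y)%g} -> injective T -> (forall a, exists k, T k = a) ->
  group_isomorphic G K.
Proof.
move=> TM Tinj /choice [f fK].
have fM : {morph f : x y / (x * y)%g}.
  by move=> a b; apply: Tinj; rewrite TM !fK.
have Tf : cancel T f by move=> k; apply: Tinj; rewrite fK.
pose F : {multiplicative G -> K} :=
  HB.pack_for {multiplicative G -> K} f (isMultiplicative.Build G K f fM).
by exists F; exists T.
Qed.

Section bundle_deck.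
Context (X : topologicalType) (H : groupType) (c : cocycle X H) (A : set X).
Local Notation E := (bundle c).
Local Notation p := (@base X H c).
Local Notation A0 := (p @^-1` A).
Local Notation p0 := (@puncture E X A0 A p (fun _ nAx => nAx)).

(* The second components of [e] and [d e] differ by a factor which is locally
   constant, hence constant. *)
Lemma bundle_puncture_deck (x : X) :
  ~ A x -> connected_space (perforated A0) -> group_isomorphic (deck p0) H.
Proof.
move=> nAx conn.
pose T k : deck p0 :=
  projT1 (cid (puncture_deck A (exist _ _ (translate_deck c k)))).
have TE k e : set_val (T k e) = translate k (set_val e).
  by rewrite /T; case: cid => d /= ->.
pose e0 : perforated A0 := @perforate E A0 (x, 1%g) nAx.
apply: (@group_isomorphic_bij _ _ T).
- move=> k l; apply: deck_inj => e; apply: val_inj.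
  by rewrite [LHS]TE [RHS]TE TE /translate /= mulgA.
- move=> k l kl; have := congr1 (fun d : deck p0 => set_val (d e0)) kl.
  by rewrite !TE => /(congr1 snd) /=; rewrite !mulg1.
move=> d0; pose d : deck p0 := d0; have [[cd _] pd] := proj2_sig d.
have baseE e : (set_val (d e)).1 = (set_val e).1.
  exact: (congr1 (fun q : perforated A0 -> perforated A => set_val (q e)) pd).
pose k e := ((set_val (d e)).2 * ((set_val e).2)^-1)%g.
have cval : continuous (fun e : perforated A0 => set_val e : E).
  exact: initial_continuous.
have cvald : continuous (fun e : perforated A0 => set_val (d e) : E).
  by move=> e; apply: continuous_comp; [exact: cd|exact: cval].
(* Near [e], both [e'] and [d e'] stay on sheets of the same index [i] over the same base point, so
   the twist cancels in the quotient [k e']. *)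
have k_near e : \forall e' \near e, k e' = k e.
  have [i Ue] := cocycle_dom_cover c (set_val e).1.
  pose s (f : E) : set E :=
    sheet i (f.2 * (cocycle_fun i f.1)^-1)%g @` cocycle_dom i.
  have os f : open (s f) by apply: sheet_open => //; exact: cocycle_dom_open.
  have sf f : cocycle_dom i f.1 -> s f f by exists f.1; rewrite ?sheetE.
  have near_e : \forall e' \near e, s (set_val e) (set_val e').
    apply: (cval e (s (set_val e))); apply: open_nbhs_nbhs.
    by split=> //; exact: sf.
  have near_de : \forall e' \near e, s (set_val (d e)) (set_val (d e')).
    apply: (cvald e (s (set_val (d e)))); apply: open_nbhs_nbhs.
    by split=> //; apply: sf; rewrite baseE.
  apply: filterS2 near_e near_de => e' [y Uy ey] [z Uz dz].
  have zy : z = y by move: (baseE e'); rewrite -ey -dz.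
  by rewrite /k -ey -dz zy /= baseE !invgM !mulgA !(mulgK, mulgVK).
exists (k e0).
have kE : [set e | k e = k e0] = setT.
  apply: conn; first by exists e0.
  - exists [set e | k e = k e0]; rewrite ?setTI // openE => e ke.
    by rewrite /interior /=; apply: filterS (k_near e) => e' /= ->.
  - exists [set e | k e = k e0]; rewrite ?setTI // -openC openE => e ke.
    by rewrite /interior /=; apply: filterS (k_near e) => e' /= ->.
apply: deck_inj => e; apply: val_inj; rewrite [LHS]TE /translate.
have <- : k e = k e0 by have : [set e | k e = k e0] e by rewrite kE.
by rewrite /k mulgVK -baseE; exact: esym (surjective_pairing _).
Qed.

End bundle_deck.

(** An injection [e] codes [H] by numbers, and [b n] is sent to the element of code [n], so
    generators alone already reach all of [H]. *)
Lemma free_of_rank_aleph0_surj (G H : groupType) :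
  free_of_rank_aleph0 G -> countable [set: H] ->
  exists phi : {multiplicative G -> H}, forall k, exists a, phi a = k.
Proof.
move=> [b freeb] /countable_injP [e einj].
have [f fe] : {f : nat -> H & forall n, (exists k, e k = n) -> e (f n) = n}.
  apply: (choice (P := fun n k => (exists k, e k = n) -> e k = n)) => n.
  by have [[k ek]|nk] := pselect (exists k, e k = n); [exists k|exists 1%g].
have [phi [phib _]] := freeb H f.
exists phi => k; exists (b (e k)); rewrite phib.
by apply: einj; rewrite ?inE //; apply: fe; exists k.
Qed.

Lemma countable_setC_neq0 (R : realType) (X : topologicalType) (x : X)
    (A : set X) : locally_euclidean R 2 X -> countable A -> ~` A !=set0.
Proof.
move=> lX cA.
have [W [v [r [f [r0 [oW _] _ fP]]]]] :=
  chart_ball lX (conj openT I : open_nbhs x setT).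
have [_ _ [g [gP _ _ gK]]] := (homeo_on_open f oW (ball_open v r)).1 fP.
have [|_ [w [Bw Aw]]] := @ball_minus_countable R v r (f @` A) r0.
  exact: card_le_trans (card_image_le _ _) cA.
by exists (g w) => Agw; apply: Aw; exists (g w) => //; exact: gK.
Qed.

Theorem proposition3p1 (R : realType) (Sigma : topologicalType)
    (surf_Sigma : surface R Sigma) (conn_Sigma : connected_space Sigma)
    (x0 : Sigma) (free_pi1 : free_of_rank_aleph0 (pi1 R x0))
    (A : set Sigma) (A_countable : countable A) (A_dense : dense A)
    (H : groupType) (H_countable : countable [set: H]) :
  exists (Sigma0 : topologicalType) (A0 : set Sigma0)
         (p0 : perforated A0 -> perforated A),
    [/\ surface R Sigma0, connected_space Sigma0, countable A0, dense A0
      & connected_space (perforated A0)] /\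
    [/\ regular_covering p0, group_isomorphic (deck p0) H
      & exists p : Sigma0 -> Sigma,
          regular_covering p /\
          forall x : perforated A0, set_val (p0 x) = p (set_val x)].
Proof.
have [pX lX] := surf_Sigma.
have [phi phi_surj] := free_of_rank_aleph0_surj free_pi1 H_countable.
pose gam x := projT1 (cid (path_connected x0 x lX conn_Sigma)).
have N_base x O (xO : open_nbhs x O) := exists_simple_nbhd lX xO.
have [N NP] : {N : Sigma -> set Sigma & forall x, N x x /\ simple_nbhd R (N x)}.
  apply: (choice (P := fun x W => W x /\ simple_nbhd R W)) => x.
  have [W [Wx _] sW] := N_base x setT (conj openT I).
  by exists W.
pose c := hol_cocycle gam phi (fun x => (NP x).1) (fun x => (NP x).2) N_base.
have lE : locally_euclidean R 2 (bundle c) := bundle_locally_euclidean lX.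
have cE : connected_space (bundle c) by exact: hol_bundle_connected.
have cA0 : countable (@base _ _ c @^-1` A) by exact: preimage_base_countable.
have cEA : connected_space (perforated (@base _ _ c @^-1` A)).
  by apply: connected_set_type; exact: connected_minus_countable lE cE cA0.
exists (bundle c), (@base _ _ c @^-1` A).
(* [A0] is by definition the preimage of [A], so the proof that the map avoids [A] is the
   identity. *)
exists (puncture (A := A) (f := @base _ _ c) (fun _ nAx => nAx)).
split; split=> //.
- by split=> //; exact: bundle_paracompact.
- exact: preimage_base_dense.
- by apply: puncture_regular; exact: base_regular.
- have [x nAx] := countable_setC_neq0 x0 lX A_countable.
  exact: bundle_puncture_deck nAx cEA.
- by exists (@base _ _ c); split; [exact: base_regular|].
Qed.
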